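(* Let $\mathcal{K}$ be a chiral $n$-polytope of type $\{p_1,\dots,p_{n-1}\}$. Assume that $\mathcal{K}$ has a quotient that is a regular maniplex with at least two facets. If $\mathcal{P}$ is a chiral extension of $\mathcal{K}$ of type $\{p_1,\dots,p_{n-1},q\}$, then for every $s\in\mathbb{N}$ (positive integer), $\mathcal{K}$ has a chiral extension of type $\{p_1,\dots,p_{n-1},\mathrm{lcm}(q,2s)\}$.
   Context: An (abstract) $n$-polytope is a partially ordered set $\mathcal{P}$ (whose elements are called faces) such that: (1) $\mathcal{P}$ has a minimum and a maximum; (2) every maximal chain (flag) has exactly $n+2$ elements, which gives a rank function onto $\{-1,\dots,n\}$; (3) (diamond condition) if $F<G$ have ranks $i-1$ and $i+1$, with $0\le i\le n-1$, there are exactly two faces $H$ with $F<H<G$; (4) (strong flag connectivity) any two flags $\Phi,\Psi$ are joined by a sequence of flags, all containing $\Phi\cap\Psi$, consecutive ones being adjacent. By (3), for each flag $\Phi$ and $0\le i\le n-1$ there is a unique flag $\Phi^i\neq\Phi$ differing from $\Phi$ exactly in the face of rank $i$ ($i$-adjacent flags). Faces of rank $n-1$ are facets; a facet $F$ is identified with the $(n-1)$-polytope $\{H:H\le F\}$. $\mathcal{P}$ is chiral if $\mathrm{Aut}(\mathcal{P})$ has exactly two orbits on flags and adjacent flags always lie in different orbits. $\mathcal{P}$ is of type (has Schläfli symbol) $\{p_1,\dots,p_{n-1}\}$ if for every $i$ and all incident faces $F<G$ of ranks $i-2$ and $i+1$, the section $\{H:F\le H\le G\}$ is the face poset of a $p_i$-gon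 ($p_i\in\{2,\dots,\infty\}$), with $p_i$ depending only on $i$; chiral polytopes have a well-defined type. An $(n+1)$-polytope $\mathcal{P}$ is an extension of an $n$-polytope $\mathcal{K}$ if all facets of $\mathcal{P}$ are isomorphic to $\mathcal{K}$; a chiral extension is an extension that is chiral. By convention $\mathrm{lcm}(\infty,2s)=\infty$. An $n$-maniplex is a connected $n$-valent graph, whose vertices are called flags, with edges properly coloured by $\{0,\dots,n-1\}$ (each colour class is a perfect matching, and distinct colours give distinct neighbours), such that for $|i-j|\ge2$ the connected components of the subgraph with edges of colours $i$ and $j$ are alternating 4-cycles. Its facets are the connected components after deleting the edges of colour $n-1$. It is regular if its group of colour-preserving graph automorphisms is transitive on flags. Every $n$-polytope determines an $n$-maniplex via its flag graph ($\Phi$ and $\Phi^i$ joined by an edge of colour $i$). A maniplex $\mathcal{R}$ is a quotient of a polytope $\mathcal{K}$ if there is a (necessarily surjective) colour-preserving graph homomorphism from the flag graph of $\mathcal{K}$ to $\mathcal{R}$. *)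

(* Defs.v *)
From HB Require Import structures.
From Stdlib Require Import Relation_Operators.
From mathcomp Require Import all_boot all_order all_algebra.
From mathcomp Require Import mathcomp_extra boolp classical_sets functions.
From mathcomp Require Import cardinality.

Set Implicit Arguments.
Unset Strict Implicit.
Unset Printing Implicit Defensive.

Local Open Scope classical_set_scope.
Local Open Scope card_scope.
Local Open Scope order_scope.

(* Polytopes may be infinite, hence posets are arbitrary [porderType]s, and
   flags are classical sets of faces. *)

Section Posets.
Context {d : Order.disp_t} (P : porderType d).
Implicit Types (F G H : P) (Phi Psi : set P).

Definition chain Phi := total_on Phi (fun F G : P => F <= G).

Definition is_flag Phi :=
  chain Phi /\ forall Psi, chain Psi -> Phi `<=` Psi -> Psi = Phi.

(* Ranks start at -1, so they are shifted by one: [height F k] says that F has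
   rank k - 1, i.e. that k faces lie strictly below F in a flag through F.  As
   soon as all flags have the same finite size, the choice of the flag is
   irrelevant. *)
Definition height F (k : nat) :=
  exists Phi, [/\ is_flag Phi, Phi F & [set G | Phi G /\ G < F] #= `I_k].

Definition section F G : set P := [set H | F <= H <= G].

(* Phi and Psi are distinct and agree except for their faces of rank i. *)
Definition flag_adjacent_at (i : nat) Phi Psi :=
  [/\ is_flag Phi, is_flag Psi, Phi <> Psi &
      forall F, ~ height F i.+1 -> (Phi F <-> Psi F)].

Definition flag_adjacent (n : nat) Phi Psi :=
  exists2 i : nat, (i < n)%N & flag_adjacent_at i Phi Psi.

Definition diamond_condition (n : nat) :=
  forall (i : nat) F G, (i < n)%N -> F < G -> height F i -> height G i.+2 ->
    [set H | F < H < G] #= `I_2.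

Definition strongly_flag_connected (n : nat) :=
  forall Phi Psi, is_flag Phi -> is_flag Psi ->
    exists (m : nat) (c : nat -> set P),
      [/\ c 0%N = Phi, c m = Psi,
          forall k, (k <= m)%N -> is_flag (c k) /\ Phi `&` Psi `<=` c k &
          forall k, (k < m)%N -> flag_adjacent n (c k) (c k.+1)].

Definition is_polytope (n : nat) :=
  [/\ (exists F, forall G, F <= G) /\ (exists F, forall G, G <= F),
      forall Phi, is_flag Phi -> Phi #= `I_n.+2,
      diamond_condition n &
      strongly_flag_connected n].

(* F is a facet of the n-polytope P: its rank is n - 1. *)
Definition is_facet (n : nat) F := height F n.

Definition is_automorphism (f : P -> P) :=
  bijective f /\ {mono f : F G / F <= G}.

Definition same_orbit Phi Psi :=
  exists2 f : P -> P, is_automorphism f & f @` Phi = Psi.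

Definition is_chiral (n : nat) :=
  (exists Phi Psi, [/\ is_flag Phi, is_flag Psi, ~ same_orbit Phi Psi &
     forall Omega, is_flag Omega ->
       same_orbit Phi Omega \/ same_orbit Psi Omega]) /\
  (forall Phi Psi, flag_adjacent n Phi Psi -> ~ same_orbit Phi Psi).

End Posets.

Definition isomorphic_subposets {d d' : Order.disp_t} {P : porderType d}
    {Q : porderType d'} (A : set P) (B : set Q) :=
  exists2 f : P -> Q, set_bij A B f & {in A &, {mono f : F G / F <= G}}.

(* The polygon whose vertices and edges are indexed by I, the edge indexed by i
   joining the vertices i and [s i]. *)
Inductive polygon (I : choiceType) (s : I -> I) :=
  | PolyBot | PolyVertex of I | PolyEdge of I | PolyTop.

Section Polygon.
Variables (I : choiceType) (s : I -> I).
Local Notation polygon := (polygon s).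

Definition polygon_encode (x : polygon) : option (option (I + I)) :=
  match x with
  | PolyBot => None
  | PolyTop => Some None
  | PolyVertex i => Some (Some (inl i))
  | PolyEdge i => Some (Some (inr i))
  end.

Definition polygon_decode (x : option (option (I + I))) : polygon :=
  match x with
  | None => PolyBot s
  | Some None => PolyTop s
  | Some (Some (inl i)) => PolyVertex s i
  | Some (Some (inr i)) => PolyEdge s i
  end.

Lemma polygon_encodeK : cancel polygon_encode polygon_decode.
Proof. by case. Qed.

HB.instance Definition _ := Choice.copy polygon (can_type polygon_encodeK).

Definition polygon_le (x y : polygon) : bool :=
  match x, y with
  | PolyBot, _ | _, PolyTop => true
  | PolyVertex i, PolyVertex j => i == j
  | PolyVertex i, PolyEdge j => (i == j) || (i == s j)
  | PolyEdge i, PolyEdge j => i == j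
  | _, _ => false
  end.

Fact polygon_le_refl : reflexive polygon_le.
Proof. by case=> //= i. Qed.

Fact polygon_le_anti : antisymmetric polygon_le.
Proof.
by case=> [|i|i|] [|j|j|] //=; rewrite ?andbF // => /andP[/eqP->].
Qed.

Fact polygon_le_trans : transitive polygon_le.
Proof.
case=> [|j|j|] [|i|i|] [|k|k|] //=.
- by move=> /eqP->.
- by move=> /eqP->.
- by move=> /[swap] /eqP->.
- by move=> /eqP->.
Qed.

Fact polygon_display : Order.disp_t. Proof. exact: Order.Disp tt tt. Qed.

HB.instance Definition _ := Order.Le_isPOrder.Build polygon_display polygon
  polygon_le_refl polygon_le_anti polygon_le_trans.

End Polygon.

(* Entries of Schlaefli symbols, in {2, 3, ..., oo}; [None] stands for oo. *)
Definition is_gon {d : Order.disp_t} {P : porderType d} (A : set P)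
    (p : option nat) :=
  match p with
  | Some k => (1 < k)%N /\ isomorphic_subposets A [set: polygon (@ordS k)]
  | None => isomorphic_subposets A [set: polygon (fun z : int => z + 1)%R]
  end.

(* The entry of index i of the symbol p is p_(i+1); it governs the sections
   between incident faces of ranks i - 1 and i + 2. *)
Definition has_type {d : Order.disp_t} (P : porderType d) (n : nat)
    (p : seq (option nat)) :=
  size p = n.-1 /\
  forall (i : nat) (F G : P), (i < n.-1)%N ->
    F < G -> height F i -> height G i.+3 ->
    is_gon (section F G) (nth None p i).

Definition lcm_oo (q : option nat) (m : nat) : option nat :=
  omap (fun k => lcmn k m) q.

Definition is_extension {d d' : Order.disp_t} (K : porderType d)
    (P : porderType d') (n : nat) :=
  is_polytope P n.+1 /\
  forall F : P, is_facet n.+1 F ->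
    isomorphic_subposets [set H : P | H <= F] [set: K].

(* Graphs with edges coloured by {0, ..., n-1}. *)
Record colgraph (n : nat) := ColGraph {
  vertex :> Type;
  edge : 'I_n -> vertex -> vertex -> Prop
}.

Section Maniplexes.
Variables (n : nat) (M : colgraph n).

(* u and v are in the same component of the subgraph of colours in C. *)
Definition linked (C : set 'I_n) : M -> M -> Prop :=
  clos_refl_trans M (fun u v => exists2 i, C i & edge i u v).

Definition alternating_4cycle (i j : 'I_n) (v0 : M) :=
  exists v1 v2 v3 : M,
    [/\ v0 <> v2 /\ v1 <> v3,
        [/\ edge i v0 v1, edge j v1 v2, edge i v2 v3 & edge j v3 v0] &
        [set w | linked [set i; j] v0 w] = [set v0; v1; v2; v3]].

Record is_maniplex : Prop := IsManiplex {
  maniplex_sym : forall i (u v : M), edge i u v -> edge i v u;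
  maniplex_irrefl : forall i (v : M), ~ edge i v v;
  maniplex_matching : forall i (v : M), exists! w : M, edge i v w;
  maniplex_simple : forall i j (u v : M), i <> j -> edge i u v -> ~ edge j u v;
  maniplex_nonempty : exists v : M, True;
  maniplex_connected : forall u v : M, linked setT u v;
  maniplex_4cycles : forall (i j : 'I_n) (v : M),
    (i.+1 < j)%N \/ (j.+1 < i)%N -> alternating_4cycle i j v
}.

Definition is_graph_automorphism (f : M -> M) :=
  bijective f /\ forall i u v, edge i u v <-> edge i (f u) (f v).

Definition is_regular_maniplex :=
  is_maniplex /\
  forall u v : M, exists2 f : M -> M, is_graph_automorphism f & f u = v.

Definition same_facet : M -> M -> Prop :=
  linked [set i : 'I_n | (i.+1 < n)%N].

Definition at_least_two_facets := exists u v : M, ~ same_facet u v.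

End Maniplexes.

Definition flag_graph {d : Order.disp_t} (n : nat) (P : porderType d) :
    colgraph n :=
  @ColGraph n {Phi : set P | is_flag Phi}
    (fun i Phi Psi => flag_adjacent_at i (sval Phi) (sval Psi)).

Definition is_graph_hom (n : nat) (M N : colgraph n) (h : M -> N) :=
  forall (i : 'I_n) (u v : M), edge i u v -> edge i (h u) (h v).

Definition is_quotient_of {d : Order.disp_t} (n : nat) (R : colgraph n)
    (K : porderType d) :=
  exists h : flag_graph n K -> R, is_graph_hom h.

(* Main.v *)
Require Import Defs.
From HB Require Import structures.
From Stdlib Require Import Relation_Operators.
From mathcomp Require Import all_boot all_order all_algebra finmap.
From mathcomp Require Import zify.
From mathcomp Require Import boolp classical_sets functions cardinality.

Set Implicit Arguments.
Unset Strict Implicit.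
Unset Printing Implicit Defensive.

Import Order.POrderTheory.

Local Open Scope classical_set_scope.
Local Open Scope card_scope.

(* The new polytope is the mix of P with a group G of permutations.  Let R be the
   regular quotient of K, v0 a flag of R and rho_i the automorphism of R that
   sends v0 to its i-adjacent flag.  The rho_i act on the first factor of
   R x Z_s; let tau send (v, z) to (v, -z) if v is in the facet of v0, and to
   (v, 1 - z) otherwise.  Then tau commutes with rho_0, ..., rho_(n-2), and as
   rho_(n-1) moves v0 out of its facet, rho_(n-1) tau has order 2s.

   Flags of the mix are the pairs (Phi, g) that can be reached from a base flag,
   where Phi is a flag of P, g is in G = <rho_0, ..., rho_(n-1), tau>, and colours
   act on both coordinates.  A word in the first n colours that fixes a flag of a
   facet K fixes a flag of R, hence all of them, and so is trivial in G: the mix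
   covers P isomorphically on facets.  Together with strong flag connectivity of
   P this yields the intersection property, and so a polytope with facets K; the
   entries of its type are the orders of products of consecutive colours.

   Left multiplication in G turns automorphisms of P into automorphisms of the
   mix, which thus has at most two flag orbits; if it had only one, some
   automorphism would send a flag to a 0-adjacent one, hence fix its facet, and K
   would not be chiral. *)

(** * Ranks in polytopes *)

(** The number lcm(q, 2s) is the order of a pair: in the last section a power of the rotation is
    trivial in the mix exactly when it is trivial in P, where the order is q, and in G. The lower
    entries must not grow in the same way, and this is the obstacle: G has to be invisible inside a
    facet, yet notice crossings between facets. Regularity of R serves the first purpose, since a
    word that closes up at one flag of R closes up at every flag. The second facet of R serves the
    other: tau can act differently on either side of a crossing. The factor 2 arises because two
    crossings are needed to return to v0; the two reflections of Z_s met on the way compose to a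
    rotation by 1. Chirality of P enters through parity: the even words, and only they, are realised
    by automorphisms of P. Ranks are shifted by one throughout, so the colours of an (n+1)-polytope
    are 1, ..., n + 1, and tau belongs to the last. *)

Section Chains.
Context {d : Order.disp_t} {P : porderType d}.
Implicit Types (F G H : P) (Phi Psi : set P).

Lemma chain_sub Phi Psi : Phi `<=` Psi -> chain Psi -> chain Phi.
Proof. by move=> sub cPsi F G /sub PF /sub PG; exact: cPsi. Qed.

Lemma chain_le1 Phi F G : chain Phi -> Phi F -> Phi G -> (F < G)%O \/ (G <= F)%O.
Proof.
move=> cPhi PF PG; have [FG|GF] := cPhi F G PF PG; last by right.
by move: FG; rewrite le_eqVlt => /orP[/eqP->|]; [right|left].
Qed.

Lemma chain_set1 F : chain [set F].
Proof. by move=> _ _ -> ->; left. Qed.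

Lemma chain_set2 F G : (F <= G)%O -> chain [set F; G].
Proof. by move=> FG _ _ [->|->] [->|->]; auto. Qed.

Lemma chain_setU1 F Phi : chain Phi ->
  (forall G, Phi G -> (F <= G)%O \/ (G <= F)%O) -> chain (F |` Phi).
Proof.
move=> cPhi FP G H [->|PG] [->|PH]; auto.
by have [] := FP _ PG; auto.
Qed.

Lemma flag_chain Phi : is_flag Phi -> chain Phi.
Proof. by case. Qed.

Lemma flag_mem Phi G : is_flag Phi ->
  (forall H, Phi H -> (G <= H)%O \/ (H <= G)%O) -> Phi G.
Proof.
move=> [cPhi maxPhi] GP; rewrite -(maxPhi (G |` Phi)); first by left.
- exact: chain_setU1.
- by move=> H; right.
Qed.

Lemma chain_ext_flag Phi : chain Phi -> exists2 Psi, is_flag Psi & Phi `<=` Psi.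
Proof.
move=> cPhi.
(* Zorn is applied to the sets whose union with [Phi] is a chain, not to the chains containing
   [Phi]: the empty family must be allowed, and its union is empty. *)
have [F FP totF|A [cA maxA]] :=
    @Zorn_bigcup P (fun Psi => chain (Phi `|` Psi)).
  move=> G H [PG|[X FX XG]] [PH|[Y FY YH]].
  - exact: cPhi.
  - by apply: (FP _ FY); [left|right].
  - by apply: (FP _ FX); [right|left].
  - have [XY|YX] := totF _ _ FX FY.
      by apply: (FP _ FY); right; rewrite //; apply: XY.
    by apply: (FP _ FX); right; rewrite //; apply: YX.
exists (Phi `|` A); last by move=> F; left.
split=> // Psi cPsi sub; apply/seteqP; split=> // F PF.
case: (pselect (A `<` Psi)) => [AP|]; last first.
  move=> nAP; right; apply: contrapT => nAF; apply: nAP.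
  split; first by move=> G AG; apply: sub; right.
  by move=> PA; apply: nAF; apply: PA.
exfalso; apply: (maxA _ AP); suff -> : Phi `|` Psi = Psi by [].
by apply/seteqP; split=> G; [case=> // PG; apply: sub; left|right].
Qed.

End Chains.

(** * Cardinalities of finite sets *)

Definition ncard (T : choiceType) (A : set T) := #|` fset_set A|%fset.

Lemma ncardE (T : choiceType) (A : set T) n : A #= `I_n -> ncard A = n.
Proof. exact: card_fset_set. Qed.

Lemma card_ncard (T : choiceType) (A : set T) : finite_set A -> A #= `I_(ncard A).
Proof. by move=> /finite_setP[n An]; rewrite (ncardE An). Qed.

Lemma ncardU (T : choiceType) (A B : set T) : finite_set A -> finite_set B ->
  A `&` B = set0 -> ncard (A `|` B) = ncard A + ncard B.
Proof.
move=> fA fB AB; rewrite /ncard fset_setU// cardfsU -fset_setI// AB fset_set0.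
by rewrite cardfs0 subn0.
Qed.

Lemma ncard_sub (T : choiceType) (A B : set T) : finite_set B -> A `<=` B ->
  ncard A <= ncard B.
Proof.
move=> fB AB; apply: fsubset_leq_card; rewrite -fset_set_sub//.
exact: sub_finite_set AB fB.
Qed.

Lemma ncard_lt (T : choiceType) (A B : set T) x : finite_set B -> A `<=` B ->
  B x -> ~ A x -> ncard A < ncard B.
Proof.
move=> fB AB Bx nAx; have fA := sub_finite_set AB fB.
have := @ncard_sub _ (x |` A) B fB; rewrite ncardU//; last first.
  by apply/seteqP; split=> // y [-> ].
rewrite (ncardE card_set1) add1n; apply=> y [->//|]; exact: AB.
Qed.

Lemma ncard_eq (T : choiceType) (A B : set T) : finite_set B -> A `<=` B ->
  ncard A = ncard B -> A = B.
Proof.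
move=> fB AB e; apply/seteqP; split=> // x Bx; apply: contrapT => nAx.
by have := ncard_lt fB AB Bx nAx; rewrite e ltnn.
Qed.

Lemma card_II_inj (T : Type) (A : set T) k l : A #= `I_k -> A #= `I_l -> k = l.
Proof. by move=> /card_esym Ak Al; apply/card_eq_II; apply: card_eq_trans Ak Al. Qed.

Lemma card_set2 (T : Type) (a b : T) : a <> b -> [set a; b] #= `I_2.
Proof.
elim/Pchoice: T => T in a b * => ab.
have fab := finite_set2 a b.
suff e : ncard [set a; b] = 2 by rewrite -e; apply: card_ncard.
rewrite ncardU// ?(ncardE card_set1)//.
by apply/seteqP; split=> // x [-> ].
Qed.

Lemma card_II2 (T : Type) (A : set T) : A #= `I_2 ->
  forall a, A a -> exists2 b, b <> a & A = [set a; b].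
Proof.
elim/Pchoice: T => T in A * => A2 a Aa.
have fA : finite_set A by apply/finite_setP; exists 2.
have [b [Ab ba]] : exists b, A b /\ b <> a.
  apply: contrapT => nb; suff e : A = [set a].
    by move: A2; rewrite e => /(card_II_inj card_set1).
  apply/seteqP; split=> [x Ax|_ ->//].
  by apply: contrapT => xa; apply: nb; exists x.
exists b => //; apply/esym/ncard_eq=> //.
  by move=> x [->|->].
by rewrite (ncardE A2); apply: ncardE; apply: card_set2 => /esym.
Qed.

(** * The rank function *)

Section Rank.
Context {d : Order.disp_t} {P : porderType d} (N : nat).
Hypothesis polyP : is_polytope P N.
Implicit Types (F G H : P) (Phi Psi : set P).

Lemma flag_card Phi : is_flag Phi -> Phi #= `I_N.+2.
Proof. by case: polyP => _ + _ _; apply. Qed.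

Lemma flag_finite Phi : is_flag Phi -> finite_set Phi.
Proof. by move=> /flag_card c; apply/finite_setP; exists N.+2. Qed.

Lemma flag_sub Phi Psi : is_flag Phi -> is_flag Psi -> Phi `<=` Psi -> Phi = Psi.
Proof. by move=> [_ m] [c _] s; rewrite (m _ c s). Qed.

Let below F Phi := [set G | Phi G /\ (G < F)%O].

Let below_finite F Phi : is_flag Phi -> finite_set (below F Phi).
Proof. by move=> /flag_finite; apply: sub_finite_set => G []. Qed.

(** The part of [Phi] below [F] and the part of [Psi] from [F] upwards glue to a flag. It has as
    many faces as [Psi], so both flags have equally many faces below [F]. *)
Lemma height_inj F k l : height F k -> height F l -> k = l.
Proof.
move=> [Phi [fPhi PhiF ck]] [Psi [fPsi PsiF cl]].
pose above := [set G | Psi G /\ (F <= G)%O].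
have fab : finite_set above by apply: sub_finite_set (flag_finite fPsi) => G [].
have e1 : ncard Psi = ncard (below F Psi) + ncard above.
  rewrite -ncardU//; first 1 last.
  - exact: below_finite.
  - apply/seteqP; split=> // G [[_ GF] [_ FG]].
    by have := lt_le_trans GF FG; rewrite ltxx.
  - congr ncard; apply/seteqP; split=> G; last by case=> -[].
    move=> PG; have [] := chain_le1 (flag_chain fPsi) PG PsiF; first by left.
    by right.
have fT : is_flag (below F Phi `|` above).
  split.
    move=> G H [[PG GF]|[PG FG]] [[PH HF]|[PH FH]].
    - exact: (flag_chain fPhi).
    - by left; apply: le_trans FH; apply: ltW.
    - by right; apply: le_trans FG; apply: ltW.
    - exact: (flag_chain fPsi).
  move=> T cT sub; apply/seteqP; split=> // G TG.
  have TF : T F by apply: sub; right.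
  have [GF|FG] := chain_le1 cT TG TF.
    left; split=> //; apply: flag_mem => // H PH.
    have [HF|FH] := chain_le1 (flag_chain fPhi) PH PhiF.
      by apply: cT => //; apply: sub; left.
    by left; apply: le_trans FH; apply: ltW.
  right; split=> //; apply: flag_mem => // H PH.
  have [HF|FH] := chain_le1 (flag_chain fPsi) PH PsiF.
    by right; apply: le_trans FG; apply: ltW.
  by apply: cT => //; apply: sub; right.
have e2 : ncard (below F Phi `|` above) = ncard (below F Phi) + ncard above.
  rewrite ncardU//; first exact: below_finite.
  apply/seteqP; split=> // G [[_ GF] [_ FG]].
  by have := lt_le_trans GF FG; rewrite ltxx.
move: e1 e2; rewrite (ncardE (flag_card fPsi)) (ncardE (flag_card fT)).
by rewrite (ncardE ck) (ncardE cl) => -> /addIn.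
Qed.

(** In a polytope every face lies on a flag, so the default value plays no part. *)
Definition rk F : nat := xget 0 [set k | height F k].

Lemma flag_height Phi F : is_flag Phi -> Phi F ->
  height F (ncard [set G | Phi G /\ (G < F)%O]).
Proof.
move=> fPhi PF; exists Phi; split=> //; apply: card_ncard; exact: below_finite.
Qed.

Lemma flag_through F : exists2 Phi, is_flag Phi & Phi F.
Proof.
have [Phi fPhi sub] := chain_ext_flag (@chain_set1 _ _ F).
by exists Phi => //; apply: sub.
Qed.

Lemma rkP F k : height F k <-> rk F = k.
Proof.
rewrite /rk; split=> [hk|<-].
  by apply: xget_unique => // l /= hl; apply: height_inj hl hk.
have [Phi fPhi PF] := flag_through F.
by apply: xgetPex; exists (ncard [set G | Phi G /\ (G < F)%O]); apply: flag_height.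
Qed.

Lemma rk_ncard Phi F : is_flag Phi -> Phi F ->
  rk F = ncard [set G | Phi G /\ (G < F)%O].
Proof. by move=> fPhi PF; apply/rkP/flag_height. Qed.

Lemma rk_lt F G : (F < G)%O -> rk F < rk G.
Proof.
move=> FG; have [Phi fPhi sub] := chain_ext_flag (@chain_set2 _ _ F G (ltW FG)).
have PF : Phi F by apply: sub; left.
have PG : Phi G by apply: sub; right.
rewrite (rk_ncard fPhi PF) (rk_ncard fPhi PG).
apply: (@ncard_lt _ _ _ F) => //.
- exact: below_finite.
- by move=> H [PH HF]; split=> //; apply: lt_trans FG.
- by move=> /= []; rewrite ltxx.
Qed.

Lemma rk_le F G : (F <= G)%O -> rk F <= rk G.
Proof.
by rewrite le_eqVlt => /orP[/eqP->//|/rk_lt/ltnW].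
Qed.

Lemma rk_max F : rk F <= N.+1.
Proof.
have [Phi fPhi PF] := flag_through F.
rewrite -ltnS (rk_ncard fPhi PF) -[X in _ < X](ncardE (flag_card fPhi)).
apply: (@ncard_lt _ _ _ F) => //.
- exact: flag_finite.
- by move=> G [].
- by move=> /= []; rewrite ltxx.
Qed.

Lemma chain_rk_inj Phi F G : chain Phi -> Phi F -> Phi G -> rk F = rk G -> F = G.
Proof.
move=> c PF PG e; have [/rk_lt|] := chain_le1 c PF PG; first by rewrite e ltnn.
by rewrite le_eqVlt => /orP[/eqP->//|/rk_lt]; rewrite e ltnn.
Qed.

Lemma chain_rk_le Phi F G : chain Phi -> Phi F -> Phi G ->
  (F <= G)%O = (rk F <= rk G).
Proof.
move=> c PF PG; apply/idP/idP; first exact: rk_le.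
have [/ltW//|] := chain_le1 c PF PG.
rewrite le_eqVlt => /orP[/eqP->//|/rk_lt].
by rewrite ltnNge => /negbTE->.
Qed.

(** The rank is injective on the [N.+2] faces of a flag and has only [N.+2] possible values, so it
    takes them all. *)
Lemma flag_face_ex Phi k : is_flag Phi -> k <= N.+1 ->
  exists2 F, Phi F & rk F = k.
Proof.
move=> fPhi kN.
suff e : rk @` Phi = `I_N.+2.
  have : `I_N.+2 k by [].
  by rewrite -e => -[F PF <-]; exists F.
apply: ncard_eq; first exact: finite_II.
  by move=> _ [F _ <-] /=; rewrite ltnS rk_max.
rewrite (ncardE (card_eqxx _)); apply: ncardE.
apply: card_eq_trans (flag_card fPhi).
apply: inj_card_eq => F G; rewrite !inE => PF PG.
by apply: chain_rk_inj PF PG; apply: flag_chain.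
Qed.

(** A flag that contains [Phi] has no further face, since [Phi] already has one of every rank. *)
Lemma chain_full_flag Phi : chain Phi ->
  (forall k, k <= N.+1 -> exists2 F, Phi F & rk F = k) -> is_flag Phi.
Proof.
move=> c full; have [Psi fPsi sub] := chain_ext_flag c.
suff -> : Phi = Psi by [].
apply/seteqP; split=> // F PF.
have [G PG e] := full _ (rk_max F).
by rewrite -(chain_rk_inj (flag_chain fPsi) (sub _ PG) PF e).
Qed.

End Rank.

(** * Adjacent flags *)

Section Words.
Variables (T : Type) (a : nat -> T -> T).

Definition acts (x : T) (w : seq nat) : T := foldl (fun y k => a k y) x w.

Lemma acts_cat x v w : acts x (v ++ w) = acts (acts x v) w.
Proof. exact: foldl_cat. Qed.

Lemma acts_filter (p : pred nat) : (forall k x, ~~ p k -> a k x = x) ->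
  forall w x, acts x (filter p w) = acts x w.
Proof.
by move=> ap; elim=> //= k w IH x; case: ifPn => [pk|/ap->] /=.
Qed.

Hypothesis aK : forall k, involutive (a k).

Lemma acts_rev x w : acts (acts x w) (rev w) = x.
Proof.
elim: w x => //= k w IH x; rewrite rev_cons -cats1 acts_cat IH /=; exact: aK.
Qed.

Hypothesis aC : forall k l x, k.+1 < l -> a k (a l x) = a l (a k x).

Lemma acts_comm m w : all (fun k => (k.+1 < m) || (m.+1 < k)) w ->
  forall x, acts (a m x) w = a m (acts x w).
Proof.
elim: w => //= k w IH /andP[km aw] x; rewrite -IH //; congr acts.
by case/orP: km => km; [rewrite aC|rewrite -aC].
Qed.

(** Letters above [k] commute with letters below [k], as they differ by at least 2. Both the
    transitivity of the face order and the intersection property of the mix rest on this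
    rearrangement. *)
Lemma acts_split k w x : k \notin w ->
  acts x w = acts (acts x [seq i <- w | k < i]) [seq i <- w | i < k].
Proof.
elim: w x => //= i w IH x; rewrite inE negb_or => /andP[ki kw].
rewrite IH //; case: (ltngtP i k) ki => // ik _ /=.
rewrite acts_comm //; apply/allP => j.
by rewrite mem_filter => /andP[kj _]; rewrite (leq_ltn_trans ik kj) orbT.
Qed.

End Words.

(** * Adjacency as an action of words on flags *)

Section Adjacency.
Context {d : Order.disp_t} {P : porderType d} (N : nat).
Hypothesis polyP : is_polytope P N.
Implicit Types (F G H : P) (Phi Psi : set P).

Let rkP := rkP polyP.

Definition adj_rel k Phi Psi :=
  [/\ is_flag Phi, is_flag Psi, Phi <> Psi &
      forall F, rk F <> k -> (Phi F <-> Psi F)].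

Lemma flag_adjacent_atP i Phi Psi :
  flag_adjacent_at i Phi Psi <-> adj_rel i.+1 Phi Psi.
Proof.
by split=> -[fP fQ n e]; split=> // F rF; apply: e; move: rF; rewrite rkP.
Qed.

Lemma adj_rel_sym k Phi Psi : adj_rel k Phi Psi -> adj_rel k Psi Phi.
Proof. by move=> [fP fQ n e]; split=> // [/esym //|F /e]; tauto. Qed.

Lemma flag_rk_inj Phi F G : is_flag Phi -> Phi F -> Phi G -> rk F = rk G -> F = G.
Proof. by move=> [c _]; exact: (chain_rk_inj polyP). Qed.

Lemma flag_rk_le Phi F G : is_flag Phi -> Phi F -> Phi G ->
  (F <= G)%O = (rk F <= rk G).
Proof. by move=> [c _]; exact: (chain_rk_le polyP). Qed.

Lemma flag_rk_lt Phi F G : is_flag Phi -> Phi F -> Phi G ->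
  (F < G)%O = (rk F < rk G).
Proof.
move=> fP PF PG; by rewrite lt_leAnge !(flag_rk_le fP)// -ltnNge; case: ltngtP.
Qed.

Lemma splice_flag Phi Psi D : is_flag Phi -> is_flag Psi -> Phi D -> Psi D ->
  is_flag [set H | Phi H /\ rk H <= rk D \/ Psi H /\ rk D <= rk H].
Proof.
move=> fP fQ PD QD; apply: (chain_full_flag polyP).
  have le F G : Phi F -> rk F <= rk D -> Psi G -> rk D <= rk G -> (F <= G)%O.
    move=> PF FD QG DG; apply: (@le_trans _ _ D).
      by rewrite (flag_rk_le fP).
    by rewrite (flag_rk_le fQ).
  move=> F G [[PF rF]|[PF rF]] [[PG rG]|[PG rG]].
  - exact: (flag_chain fP).
  - by left; apply: le.
  - by right; apply: le.
  - exact: (flag_chain fQ).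
move=> k kN; have [kD|Dk] := leqP k (rk D).
  have [F PF rF] := flag_face_ex polyP fP kN.
  by exists F => //; left; rewrite rF.
have [F PF rF] := flag_face_ex polyP fQ kN.
by exists F => //; right; rewrite rF ltnW.
Qed.

Lemma diamond k F G : 0 < k <= N -> (F < G)%O -> rk F = k.-1 -> rk G = k.+1 ->
  [set H | F < H < G]%O #= `I_2.
Proof.
move=> /andP[k0 kN] FG rF rG; case: polyP => _ _ dia _.
by apply: (dia k.-1) => //; [|exact/rkP|apply/rkP]; rewrite prednK.
Qed.

(** The faces of rank [k.-1] and [k.+1] of [Phi] bound a diamond. Its face [B] outside [Phi]
    replaces the face of rank [k], and any adjacent flag must contain [B]. *)
Lemma adj_rel_ex k Phi : is_flag Phi -> 0 < k <= N ->
  exists2 Psi, adj_rel k Phi Psi & forall Psi', adj_rel k Phi Psi' -> Psi' = Psi.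
Proof.
move=> fP kN; have /andP[k0 kN'] := kN.
have [F PF rF] : exists2 F, Phi F & rk F = k.-1.
  by apply: (flag_face_ex polyP fP); lia.
have [A PA rA] : exists2 F, Phi F & rk F = k.
  by apply: (flag_face_ex polyP fP); lia.
have [G PG rG] : exists2 F, Phi F & rk F = k.+1.
  by apply: (flag_face_ex polyP fP); lia.
have FA : (F < A)%O by rewrite (flag_rk_lt fP)//; lia.
have AG : (A < G)%O by rewrite (flag_rk_lt fP)//; lia.
have [|B BA eFG] := card_II2 (diamond kN (lt_trans FA AG) rF rG) (a := A).
  by rewrite /= FA AG.
have /andP[FB BG] : (F < B < G)%O.
  suff : [set H | (F < H < G)%O] B by [].
  by rewrite eFG; right.
have rB : rk B = k.
  by have := rk_lt polyP FB; have := rk_lt polyP BG; lia.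
pose Psi := [set H | Phi H /\ rk H <> k \/ H = B].
have fQ : is_flag Psi.
  apply: (chain_full_flag polyP).
    have cmp H : Phi H -> rk H <> k -> (H <= B)%O \/ (B <= H)%O.
      move=> PH rH; have [Hk|kH] : rk H <= k.-1 \/ k.+1 <= rk H by lia.
        left; apply: le_trans (ltW FB); rewrite (flag_rk_le fP)//; lia.
      right; apply: le_trans (ltW BG) _; rewrite (flag_rk_le fP)//; lia.
    move=> H1 H2 [[PH1 r1]|->] [[PH2 r2]|->]; auto.
    - exact: (flag_chain fP).
    - by have [] := cmp _ PH2 r2; auto.
  move=> j jN; have [->|/eqP jk] := eqVneq j k; first by exists B => //; right.
  have [H PH rH] := flag_face_ex polyP fP jN.
  by exists H => //; left; rewrite rH.
exists Psi.
  split=> //.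
    move=> e; apply: BA; apply: (flag_rk_inj fP) => //; last by rewrite rA.
    by rewrite e; right.
  move=> H rH; split=> [PH|[[]//|e]]; first by left.
  by case: rH; rewrite e.
move=> Q' [_ fQ' nQ' eQ'].
have [B' QB rB'] : exists2 B, Q' B & rk B = k.
  by apply: (flag_face_ex polyP fQ'); lia.
have QF : Q' F by apply/eQ' => //; lia.
have QG : Q' G by apply/eQ' => //; lia.
have : [set H | (F < H < G)%O] B'.
  by rewrite /= !(flag_rk_lt fQ')//; apply/andP; split; lia.
rewrite eFG => -[/= eB|/= eB]; rewrite {}eB in QB rB'.
  case: nQ'; apply: (flag_sub fP fQ') => H PH.
  have [rH|/eqP rH] := eqVneq (rk H) k; last exact/eQ'.
  by rewrite (flag_rk_inj fP PH PA) // rH rA.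
apply/esym/(flag_sub fQ fQ') => H [[PH rH]|->//].
exact/eQ'.
Qed.

Definition adj k Phi : set P :=
  if 0 < k <= N then xget Phi [set Psi | adj_rel k Phi Psi] else Phi.

Lemma adj_adj_rel k Phi : is_flag Phi -> 0 < k <= N -> adj_rel k Phi (adj k Phi).
Proof.
move=> fP kN; rewrite /adj kN.
by have [Psi r _] := adj_rel_ex fP kN; apply: xgetPex; exists Psi.
Qed.

Lemma adj_uniq k Phi Psi : 0 < k <= N -> adj_rel k Phi Psi -> adj k Phi = Psi.
Proof.
move=> kN r; have fP : is_flag Phi by case: r.
have [Q _ uQ] := adj_rel_ex fP kN.
by rewrite (uQ _ r); apply: uQ; apply: adj_adj_rel.
Qed.

Lemma adj_id k Phi : ~~ (0 < k <= N) -> adj k Phi = Phi.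
Proof. by rewrite /adj => /negbTE->. Qed.

Lemma adj_flag k Phi : is_flag Phi -> is_flag (adj k Phi).
Proof.
move=> fP; have [kN|kN] := boolP (0 < k <= N); last by rewrite adj_id.
by case: (adj_adj_rel fP kN).
Qed.

Lemma adj_neq k Phi : is_flag Phi -> 0 < k <= N -> adj k Phi <> Phi.
Proof. by move=> fP kN; case: (adj_adj_rel fP kN) => _ _ /[swap] _ /[swap] ->. Qed.

Lemma adj_face k Phi F : is_flag Phi -> rk F <> k -> (adj k Phi F <-> Phi F).
Proof.
move=> fP rF; have [kN|kN] := boolP (0 < k <= N); last by rewrite adj_id.
by case: (adj_adj_rel fP kN) => _ _ _ /(_ F rF); tauto.
Qed.

Lemma adjK k Phi : is_flag Phi -> adj k (adj k Phi) = Phi.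
Proof.
move=> fP; have [kN|kN] := boolP (0 < k <= N); last by rewrite !adj_id.
by apply: adj_uniq => //; apply: adj_rel_sym; apply: adj_adj_rel.
Qed.

(** When both colours are effective, the two sides equal the flag [Psi] spliced at the face [D] of
    rank [k.+1], strictly between the colours: below [D] it follows the [k]-adjacent flag, above it
    the [l]-adjacent one. *)
Lemma adjC k l Phi : is_flag Phi -> k.+1 < l -> adj k (adj l Phi) = adj l (adj k Phi).
Proof.
move=> fP kl; have [kN|kN] := boolP (0 < k <= N); last by rewrite !(adj_id _ kN).
have [lN|lN] := boolP (0 < l <= N); last by rewrite !(adj_id _ lN).
have [D PD rD] : exists2 D, Phi D & rk D = k.+1.
  by apply: (flag_face_ex polyP fP); lia.
have fPk := adj_flag k fP; have fPl := adj_flag l fP.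
have kD : adj k Phi D by apply/adj_face => //; lia.
have lD : adj l Phi D by apply/adj_face => //; lia.
pose Psi := [set H | adj k Phi H /\ rk H <= rk D \/ adj l Phi H /\ rk D <= rk H].
have fQ : is_flag Psi := splice_flag fPk fPl kD lD.
have akl F : rk F <> k -> adj l Phi F <-> Psi F.
  move=> rF; split=> [aF|[[aF rD']|[]//]].
    have [rFD|rFD] := leqP (rk F) (rk D); last by right; split=> //; exact: ltnW.
    by left; split=> //; apply/adj_face => //; move: aF; rewrite adj_face//; lia.
  by apply/adj_face => //; [lia|move: aF; rewrite adj_face].
have alk F : rk F <> l -> adj k Phi F <-> Psi F.
  move=> rF; split=> [aF|[[]//|[aF rD']]].
    have [rFD|rFD] := leqP (rk F) (rk D); first by left.
    right; split; last exact: ltnW.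
    by apply/adj_face => //; move: aF; rewrite adj_face//; lia.
  by apply/adj_face => //; [lia|move: aF; rewrite adj_face].
transitivity Psi.
  apply: adj_uniq => //; split=> // e.
  apply: (adj_neq fP kN); apply: (flag_sub fPk fP) => F aF.
  have [rF|rF] := eqVneq (rk F) l; last first.
    apply/(@adj_face l) => //; first exact/eqP.
    by rewrite e; apply/alk => //; apply/eqP.
  by move: aF; rewrite adj_face//; lia.
apply/esym/adj_uniq => //; split=> // e.
apply: (adj_neq fP lN); apply: (flag_sub fPl fP) => F aF.
have [rF|rF] := eqVneq (rk F) k; last first.
  apply/(@adj_face k) => //; first exact/eqP.
  by rewrite e; apply/akl => //; apply/eqP.
by move: aF; rewrite adj_face//; lia.
Qed.

Lemma acts_flag Phi w : is_flag Phi -> is_flag (acts adj Phi w).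
Proof. by elim: w Phi => //= k w IH Phi /(adj_flag k)/IH. Qed.

Lemma acts_face Phi w F : is_flag Phi -> rk F \notin w ->
  acts adj Phi w F <-> Phi F.
Proof.
elim: w Phi => //= k w IH Phi fP; rewrite inE negb_or => /andP[/eqP rF rw].
by rewrite IH //; [exact: adj_face|exact: adj_flag].
Qed.

(** All flags of a connecting sequence contain the common faces. A step at the rank of a common face
    would change nothing, so these ranks do not occur as letters. *)
Lemma flag_connect Phi Psi : is_flag Phi -> is_flag Psi ->
  exists w, [/\ acts adj Phi w = Psi, all (fun k => 0 < k <= N) w &
    forall F, Phi F -> Psi F -> rk F \notin w].
Proof.
move=> fP fQ; case: polyP => _ _ _ /(_ _ _ fP fQ)[m [c [c0 cm cf ca]]].
suff : forall j, j <= m -> exists w, [/\ acts adj Phi w = c j,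
    all (fun k => 0 < k <= N) w & forall F, Phi F -> Psi F -> rk F \notin w].
  by move=> /(_ m (leqnn m)); rewrite cm.
elim=> [|j IH] jm; first by exists [::]; rewrite c0.
have [w [ew aw rw]] := IH (ltnW jm).
have [i iN /flag_adjacent_atP r] := ca j jm.
exists (rcons w i.+1); split.
- by rewrite -cats1 acts_cat ew /=; apply: adj_uniq.
- by rewrite all_rcons aw iN.
move=> F PF QF; rewrite mem_rcons inE negb_or rw// andbT.
apply/eqP => rF; case: r => fc fc' ne e; apply: ne.
have cF : c j F by have [_] := cf j (ltnW jm); apply.
have cF' : c j.+1 F by have [_] := cf j.+1 jm; apply.
apply: (flag_sub fc fc') => G cG.
have [rG|/eqP rG] := eqVneq (rk G) i.+1; last exact/e.
by rewrite (flag_rk_inj fc cG cF)// rG.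
Qed.

End Adjacency.

(** * Polytopes from flag systems *)

(* A maniplex of rank N satisfying the intersection property [act_inter].  The
   colour k changes the face of shifted rank k; colours outside 1, ..., N act
   trivially, so that words need no bounds. *)
Record flag_system (N : nat) := FlagSystem {
  fl :> Type;
  act : nat -> fl -> fl;
  actK : forall k, involutive (act k);
  actC : forall k l x, k.+1 < l -> act k (act l x) = act l (act k x);
  act_id : forall k x, ~~ (0 < k <= N) -> act k x = x;
  act_neq : forall k x, 0 < k <= N -> act k x <> x;
  fl_ex : exists x : fl, True;
  act_connect : forall x y, exists w, acts act x w = y;
  act_inter : forall (x y : fl) (S : set nat),
    (forall k, S k -> exists2 w, k \notin w & acts act x w = y) ->
    exists2 w, (forall k, S k -> k \notin w) & acts act x w = y
}.

Section FacePoset.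
Variables (N : nat) (X : flag_system N).
Implicit Types (x y : X) (k l : nat).
Local Notation "x ∙ w" := (acts (@act N X) x w) (at level 45, left associativity).

(** The flags that are to share with [x] its face of rank [k]. *)
Definition face_class k x : set X := [set y | exists2 w, k \notin w & x ∙ w = y].

Lemma face_class_refl k x : face_class k x x.
Proof. by exists [::]. Qed.

Lemma face_class_sym k x y : face_class k x y -> face_class k y x.
Proof.
move=> [w kw <-]; exists (rev w); first by rewrite mem_rev.
exact/acts_rev/actK.
Qed.

Lemma face_class_trans k x y z :
  face_class k x y -> face_class k y z -> face_class k x z.
Proof.
move=> [v kv <-] [w kw <-]; exists (v ++ w); last by rewrite acts_cat.
by rewrite mem_cat negb_or kv.
Qed.

Lemma face_class_eq k x y : face_class k x y -> face_class k x = face_class k y.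
Proof.
move=> xy; apply/seteqP; split=> z; apply: face_class_trans => //.
exact: face_class_sym.
Qed.

Lemma face_class_act k l x : k != l -> face_class k x (act l x).
Proof. by move=> kl; exists [:: l] => //; rewrite inE. Qed.

Lemma face_class_acts k x w : k \notin w -> face_class k x (x ∙ w).
Proof. by exists w. Qed.

Lemma face_class_top k x y : ~~ (0 < k <= N) -> face_class k x y.
Proof.
move=> kN; have [w <-] := act_connect x y.
exists [seq i <- w | i != k]; first by rewrite mem_filter eqxx.
apply: acts_filter => l z; rewrite negbK => /eqP ->; exact: act_id.
Qed.

(** A face is coded by the class of flags through it. The rank is kept alongside because classes of
    different ranks may coincide: for ranks 0 and [N.+1] the class is the whole of [X]. *)
Record face := Face {
  face_code : nat * set X;
  face_codeP :
    `[< exists2 x, face_code.1 <= N.+1 & face_code.2 = face_class face_code.1 x >]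
}.

HB.instance Definition _ := [isSub for face_code].
HB.instance Definition _ := [Choice of face by <:].

Implicit Types F G H : face.

Definition frk F := (face_code F).1.
Definition fcl F := (face_code F).2.

Lemma frk_max F : frk F <= N.+1.
Proof. by case: F => -[k C] h; have /asboolP[x] := h. Qed.

Lemma fcl_ex F : exists x, fcl F x.
Proof.
case: F => -[k C] h; have /asboolP[x _ /= e] := h.
by exists x; rewrite /fcl /= e; exact: face_class_refl.
Qed.

Lemma fclE F x : fcl F x -> fcl F = face_class (frk F) x.
Proof.
case: F => -[k C] h; have /asboolP[y _ /= e] := h.
rewrite /fcl /frk /= e; exact: face_class_eq.
Qed.

Lemma face_eq F G : frk F = frk G -> fcl F = fcl G -> F = G.
Proof.
case: F => -[k C] p; case: G => -[l D] q; rewrite /frk /fcl /= => e1 e2.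
by apply: val_inj; rewrite /= e1 e2.
Qed.

Lemma face_eq_mem F G x : frk F = frk G -> fcl F x -> fcl G x -> F = G.
Proof. by move=> e Fx Gx; apply: face_eq => //; rewrite (fclE Fx) (fclE Gx) e. Qed.

Fact mkface_subproof k x : `[< exists2 x',
  (minn k N.+1, face_class (minn k N.+1) x).1 <= N.+1 &
  (minn k N.+1, face_class (minn k N.+1) x).2 =
    face_class (minn k N.+1, face_class (minn k N.+1) x).1 x' >].
Proof. by apply/asboolP; exists x => //=; exact: geq_minr. Qed.

(* Ranks above N + 1 are truncated. *)
Definition mkface k x : face := Face (mkface_subproof k x).

Lemma frk_mkface k x : k <= N.+1 -> frk (mkface k x) = k.
Proof. by move=> kN; rewrite /frk /=; apply/minn_idPl. Qed.

Lemma fcl_mkface k x : fcl (mkface k x) x.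
Proof. exact: face_class_refl. Qed.

Lemma mkfaceE F x : fcl F x -> F = mkface (frk F) x.
Proof.
move=> Fx; apply: (face_eq_mem _ Fx (fcl_mkface _ _)).
by rewrite frk_mkface // frk_max.
Qed.

Definition face_le F G := `[< frk F <= frk G /\ exists x, fcl F x /\ fcl G x >].

Fact face_le_refl : reflexive face_le.
Proof. by move=> F; apply/asboolP; split=> //; have [x Fx] := fcl_ex F; exists x. Qed.

Fact face_le_anti : antisymmetric face_le.
Proof.
move=> F G /andP[/asboolP[FG [x [Fx Gx]]] /asboolP[GF _]].
by apply: (face_eq_mem _ Fx Gx); apply/eqP; rewrite eqn_leq FG.
Qed.

(* A word avoiding the rank of a face splits into a part above and a part below
   it; the intermediate flag has the faces of [x] up to that rank, and those of
   [y] from that rank on. *)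
Lemma fcl_split F x y : fcl F x -> fcl F y ->
  exists z, (forall G, frk G <= frk F -> fcl G x -> fcl G z) /\
    (forall G, frk F <= frk G -> fcl G y -> fcl G z).
Proof.
move=> Fx; rewrite (fclE Fx) => -[w kw ewy].
exists (x ∙ [seq i <- w | frk F < i]); split=> [G rG Gx|G rG Gy].
  rewrite (fclE Gx); apply: face_class_acts; rewrite mem_filter; apply/negP; lia.
rewrite (fclE Gy); apply: face_class_sym; rewrite -ewy.
rewrite (acts_split (@actC N X) x kw).
by apply: face_class_acts; rewrite mem_filter; apply/negP; lia.
Qed.

Fact face_le_trans : transitive face_le.
Proof.
move=> G F H /asboolP[FG [x [Fx Gx]]] /asboolP[GH [y [Gy Hy]]].
apply/asboolP; split; first exact: leq_trans GH.
by have [z [z1 z2]] := fcl_split Gx Gy; exists z; split; [exact: z1|exact: z2].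
Qed.

Fact face_display : Order.disp_t. Proof. exact: Order.Disp tt tt. Qed.

HB.instance Definition _ := Order.Le_isPOrder.Build face_display face
  face_le_refl face_le_anti face_le_trans.

Lemma face_leP F G :
  reflect (frk F <= frk G /\ exists x, fcl F x /\ fcl G x) (F <= G)%O.
Proof. exact: asboolP. Qed.

Lemma face_le_mem F G x : fcl F x -> fcl G x -> (F <= G)%O = (frk F <= frk G).
Proof.
move=> Fx Gx; apply/face_leP/idP => [[]//|FG]; split=> //; by exists x.
Qed.

Lemma face_lt_mem F G x : fcl F x -> fcl G x -> (F < G)%O = (frk F < frk G).
Proof. by move=> Fx Gx; rewrite lt_leAnge !(@face_le_mem _ _ x)//; case: ltngtP. Qed.

Lemma face_lt_rk F G : (F < G)%O -> frk F < frk G.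
Proof.
rewrite lt_neqAle => /andP[FG /face_leP[le [x [Fx Gx]]]].
rewrite ltn_neqAle le andbT; apply: contraNneq FG => e.
by rewrite (face_eq_mem e Fx Gx).
Qed.

(** Induction on ranks from below: a flag [x] through the faces of [Phi] of rank below [m] is
    spliced, at the highest of these faces, with a flag [y] through that face and the one of rank
    [m]. *)
Lemma chain_common (Phi : set face) : chain Phi ->
  exists x, forall F, Phi F -> fcl F x.
Proof.
move=> cPhi.
have same F G : Phi F -> Phi G -> frk F = frk G -> F = G.
  move=> PF PG e; have [] := cPhi _ _ PF PG => /face_leP[_ [x [? ?]]];
  exact: (face_eq_mem e (x := x)).
suff common m : exists x, forall F, Phi F -> frk F < m -> fcl F x.
  have [x xP] := common N.+2; exists x => F PF; apply: xP => //; exact: frk_max.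
elim: m => [|m [x IH]]; first by have [x _] := fl_ex X; exists x.
case: (pselect (exists2 F, Phi F & frk F = m)) => [[F PF rF]|nF]; last first.
  exists x => F PF; rewrite ltnS leq_eqVlt => /orP[/eqP rF|]; last exact: IH.
  by case: nF; exists F.
pose p k := `[< exists2 G, Phi G & frk G = k /\ k < m >].
case: (pselect (exists k, p k)) => [exp|np]; last first.
  have [y Fy] := fcl_ex F; exists y => G PG.
  rewrite ltnS leq_eqVlt => /orP[/eqP rG|rG]; first by rewrite (same G F) ?rG.
  by case: np; exists (frk G); apply/asboolP; exists G.
have pm k : p k -> k <= m by move=> /asboolP[G _ [_ /ltnW]].
case: (ex_maxnP exp pm) => k /asboolP[G PG [rG km]] kmax.
have Gx : fcl G x by apply: IH => //; rewrite rG.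
have /face_leP[_ [y [Gy Fy]]] : (G <= F)%O.
  by have [//|/face_leP[]] := cPhi _ _ PG PF; rewrite rF rG leqNgt km.
have [z [z1 z2]] := fcl_split Gx Gy; exists z => H PH.
rewrite ltnS leq_eqVlt => /orP[/eqP rH|rH].
  by rewrite (same H F) ?rH//; apply: z2 => //; rewrite rF rG ltnW.
apply: z1; last exact: IH.
by rewrite rG; apply: kmax; apply/asboolP; exists H.
Qed.

Definition Fl x : set face := [set F | fcl F x].

Lemma Fl_mkface k x : Fl x (mkface k x).
Proof. exact: fcl_mkface. Qed.

Lemma Fl_chain x : chain (Fl x).
Proof.
move=> F G Fx Gx; rewrite !(face_le_mem (x := x))//; apply/orP; exact: leq_total.
Qed.

Lemma Fl_flag x : is_flag (Fl x).
Proof.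
split=> [|Psi cPsi sub]; first exact: Fl_chain.
apply/seteqP; split=> // F PF.
have [y yP] := chain_common cPsi.
have e : F = mkface (frk F) x.
  apply: (@face_eq_mem _ _ y); [|exact: yP|].
  - by rewrite frk_mkface // frk_max.
  - by apply: yP; apply: sub; apply: Fl_mkface.
by rewrite e; apply: Fl_mkface.
Qed.

Lemma flag_Fl Phi : is_flag Phi -> exists x, Phi = Fl x.
Proof.
move=> [cPhi maxPhi]; have [x xP] := chain_common cPhi.
by exists x; rewrite (maxPhi (Fl x)) //; exact: Fl_chain.
Qed.

Lemma Fl_card_below x m : m <= N.+2 -> [set F | Fl x F /\ frk F < m] #= `I_m.
Proof.
move=> mN.
have -> : [set F | Fl x F /\ frk F < m] = (fun k => mkface k x) @` `I_m.
  apply/seteqP; split=> [F [Fx rF]|_ [k /= km <-]].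
    by exists (frk F) => //; rewrite -mkfaceE.
  split; first exact: Fl_mkface.
  by rewrite frk_mkface // -ltnS (leq_trans km).
apply: inj_card_eq => k l; rewrite !inE /= => km lm e.
by rewrite -[k](@frk_mkface _ x) ?e ?frk_mkface // -ltnS ?(leq_trans km) ?(leq_trans lm).
Qed.

Lemma Fl_card x : Fl x #= `I_N.+2.
Proof.
rewrite -[X in X #= _](_ : [set F | Fl x F /\ frk F < N.+2] = _).
  exact: Fl_card_below.
apply/seteqP; split=> [F []//|F Fx]; split=> //; exact: frk_max.
Qed.

Lemma heightP F k : height F k <-> frk F = k.
Proof.
have card x : fcl F x -> [set G | Fl x G /\ (G < F)%O] #= `I_(frk F).
  move=> Fx; rewrite -[X in X #= _](_ : [set G | Fl x G /\ frk G < frk F] = _).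
    by apply: Fl_card_below; exact: leqW (frk_max F).
  by apply/seteqP; split=> G [Gx]; [rewrite -(face_lt_mem Gx Fx)|rewrite (face_lt_mem Gx Fx)].
split=> [[Phi [/flag_Fl[x ->] Fx ck]]|<-].
  exact: card_II_inj (card x Fx) ck.
by have [x Fx] := fcl_ex F; exists (Fl x); split=> //; [exact: Fl_flag|exact: card].
Qed.

(** Each common face yields a word avoiding its rank; the intersection property merges these into a
    single word. *)
Lemma Fl_inter x y : exists2 w, (forall F, Fl x F -> Fl y F -> frk F \notin w) &
  x ∙ w = y.
Proof.
have [k [F Fx [Fy <-]]|w wP xw] := @act_inter N X x y
    [set k | exists2 F, Fl x F & Fl y F /\ frk F = k].
  by have := Fy; rewrite /Fl /= (fclE Fx).
by exists w => // F Fx Fy; apply: wP; exists F.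
Qed.

(** If all faces are common, the word of [Fl_inter] has only letters outside 1, ..., [N], which act
    trivially. *)
Lemma Fl_inj : injective Fl.
Proof.
move=> x y e; have [w wP <-] := Fl_inter x y.
have aw : all (fun k => ~~ (0 < k <= N)) w.
  apply/allP => k kw; apply/negP => kN.
  have := wP (mkface k x) (fcl_mkface k x).
  by rewrite -e => /(_ (fcl_mkface k x)); rewrite frk_mkface ?kw//; lia.
rewrite -(@acts_filter _ _ (fun k => 0 < k <= N)) => [|k z /act_id//].
by rewrite (_ : filter _ w = [::])//; apply/eqP; rewrite -size_eq0 size_filter -leqn0 leqNgt -has_count -all_predC.
Qed.

(** Up to trivial letters, the word of [Fl_inter] uses [k] only, and [act k] is an involution. *)
Lemma Fl_agree k x y :
  (forall F, frk F <> k -> (Fl x F <-> Fl y F)) -> y = x \/ y = act k x.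
Proof.
move=> ag; have [w wP xw] := Fl_inter x y; rewrite -{y}xw in ag wP *.
have aw l : 0 < l <= N -> l \in w -> l = k.
  move=> lN lw; apply: contrapT => lk.
  have rl : frk (mkface l x) = l by rewrite frk_mkface //; lia.
  have ly : Fl (x ∙ w) (mkface l x) by apply/ag; [rewrite rl|exact: fcl_mkface].
  by have := wP _ (fcl_mkface l x) ly; rewrite rl lw.
have : all (fun l => (0 < l <= N) ==> (l == k)) w.
  by apply/allP => l lw; apply/implyP => lN; apply/eqP/aw.
elim/last_ind: w {wP aw ag} => [|w l IH]; first by left.
rewrite all_rcons => /andP[lk /IH{}IH]; rewrite -cats1 acts_cat /=.
have [lN|lN] := boolP (0 < l <= N); last by rewrite act_id.
rewrite lN /= in lk; rewrite (eqP lk).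
by case: IH => ->; [right|left; rewrite actK].
Qed.

Lemma Fl_act k x F : frk F <> k -> (Fl x F <-> Fl (act k x) F).
Proof.
move=> /eqP rF; have xx := face_class_act x rF; rewrite /Fl /=; split=> Fx.
  by rewrite (fclE Fx).
by rewrite (fclE Fx); apply: face_class_sym.
Qed.

Lemma Fl_adjacent i x : i < N -> flag_adjacent_at i (Fl x) (Fl (act i.+1 x)).
Proof.
move=> iN; split; [exact: Fl_flag|exact: Fl_flag| |].
  by move=> /Fl_inj/esym; exact: act_neq.
by move=> F rF; apply: Fl_act => e; apply: rF; apply/heightP.
Qed.

Lemma adjacent_Fl i x y : flag_adjacent_at i (Fl x) (Fl y) -> y = act i.+1 x.
Proof.
move=> [_ _ ne ag]; suff /Fl_agree[e|//] : forall F, frk F <> i.+1 -> Fl x F <-> Fl y F.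
  by case: ne; rewrite e.
by move=> F rF; apply: ag; rewrite heightP.
Qed.

(** A face [H] strictly between has rank [i.+1] and forms a chain with the other faces of [x]. A
    flag through this chain agrees with [x] off rank [i.+1], hence is [x] or its neighbour. *)
Lemma face_diamond : @diamond_condition _ face N.
Proof.
move=> i F G iN FG /heightP rF /heightP rG.
have [x xP] := chain_common (chain_set2 (ltW FG)).
have Fx : fcl F x by apply: xP; left.
have Gx : fcl G x by apply: xP; right.
have Fx' : fcl F (act i.+1 x) by apply: (@Fl_act i.+1 x F _).1 => //; rewrite rF; lia.
have Gx' : fcl G (act i.+1 x) by apply: (@Fl_act i.+1 x G _).1 => //; rewrite rG; lia.
have rk z : frk (mkface i.+1 z) = i.+1 by rewrite frk_mkface //; lia.
suff -> : [set H | (F < H < G)%O] = [set mkface i.+1 x; mkface i.+1 (act i.+1 x)].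
  apply: card_set2 => e; apply: (@act_neq N X i.+1 x) => //.
  apply: Fl_inj; apply/seteqP; split=> H.
    move=> Hx; have [rH|/eqP rH] := eqVneq (frk H) i.+1; last exact: (Fl_act x rH).2.
    by rewrite (mkfaceE Hx) rH -e; exact: fcl_mkface.
  move=> Hx; have [rH|/eqP rH] := eqVneq (frk H) i.+1; last exact: (Fl_act x rH).1.
  by rewrite (mkfaceE Hx) rH e; exact: fcl_mkface.
apply/seteqP; split=> [H /andP[FH HG]|H].
  have rH : frk H = i.+1.
    by have := face_lt_rk FH; have := face_lt_rk HG; rewrite rF rG; lia.
  have cH : chain (H |` [set E | Fl x E /\ frk E <> i.+1]).
    apply: chain_setU1; first by apply: chain_sub (@Fl_chain x) => E [].
    move=> E [Ex rE]; have [Ei|iE] : frk E <= i \/ i.+2 <= frk E by lia.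
      right; apply: le_trans (ltW FH); by rewrite (face_le_mem Ex Fx) rF.
    left; apply: le_trans (ltW HG) _; by rewrite (face_le_mem Gx Ex) rG.
  have [y yP] := chain_common cH.
  have Hy : fcl H y by apply: yP; left.
  have xy E : frk E <> i.+1 -> Fl x E <-> Fl y E.
    move=> rE; split=> [Ex|Ey]; first by apply: yP; right.
    have Exy : E = mkface (frk E) x.
      apply: (@face_eq_mem _ _ y) => //; first by rewrite frk_mkface // frk_max.
      apply: yP; right; split; first exact: Fl_mkface.
      by rewrite frk_mkface // frk_max.
    by rewrite Exy; exact: Fl_mkface.
  have [e|e] := Fl_agree xy; subst y; [left|right];
    by rewrite (mkfaceE Hy) rH.
by move=> [->|->] /=; [rewrite !(face_lt_mem (x := x))|rewrite !(face_lt_mem (x := act i.+1 x))] => //;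
  rewrite ?rk ?rF ?rG ?ltnSn //; exact: fcl_mkface.
Qed.

Lemma face_strongly_connected : @strongly_flag_connected _ face N.
Proof.
move=> Phi Psi /flag_Fl[x ->] /flag_Fl[y ->].
have [v vP vy] := Fl_inter x y.
(* The prefixes of [w] give the sequence of flags; trivial letters are removed, as they would repeat
   a flag. *)
pose w := [seq k <- v | 0 < k <= N].
have wP F : Fl x F -> Fl y F -> frk F \notin w.
  by move=> Fx Fy; rewrite mem_filter negb_and vP// orbT.
have wy : x ∙ w = y by rewrite acts_filter // => k z; exact: act_id.
exists (size w), (fun j => Fl (x ∙ take j w)); split.
- by rewrite take0.
- by rewrite take_size wy.
- move=> j jw; split; first exact: Fl_flag.
  move=> F [Fx Fy]; rewrite /Fl /= (fclE Fx); apply: face_class_acts.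
  by apply: contra (wP F Fx Fy) => /mem_take.
- move=> j jw; rewrite (take_nth 0 jw) -cats1 acts_cat /=.
  have : nth 0 w j \in w by exact: mem_nth.
  rewrite mem_filter => /andP[/andP[k0 kN] _].
  by exists (nth 0 w j).-1; [|rewrite -{2}(prednK k0); apply: Fl_adjacent]; rewrite prednK.
Qed.

Theorem face_polytope : @is_polytope _ face N.
Proof.
split; [|by move=> Phi /flag_Fl[x ->]; exact: Fl_card|exact: face_diamond|
        exact: face_strongly_connected].
have [x _] := fl_ex X; split; [exists (mkface 0 x)|exists (mkface N.+1 x)] => F.
  have [y Fy] := fcl_ex F; apply/face_leP; rewrite frk_mkface //; split=> //.
  exists y; split=> //; exact: face_class_top.
have [y Fy] := fcl_ex F; apply/face_leP; rewrite frk_mkface ?frk_max //; split=> //.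
exists y; split=> //; rewrite (fclE (fcl_mkface N.+1 x)) frk_mkface //.
by apply: face_class_top; rewrite ltnn andbF.
Qed.

Lemma face_rk F : rk F = frk F.
Proof. exact/(rkP face_polytope)/heightP. Qed.

Lemma adj_Fl k x : adj N k (Fl x) = Fl (act k x).
Proof.
have [kN|kN] := boolP (0 < k <= N); last by rewrite adj_id // act_id.
apply: (adj_uniq face_polytope) => //; have /andP[k0 kN'] := kN.
rewrite -(prednK k0); apply/(flag_adjacent_atP face_polytope)/Fl_adjacent.
by rewrite prednK.
Qed.

Lemma acts_Fl x w : acts (adj N) (Fl x) w = Fl (x ∙ w).
Proof. by elim: w x => //= k w IH x; rewrite adj_Fl IH. Qed.

End FacePoset.

(** * Facets and orbits of flags *)

Section LowerSection.
Context {d d' : Order.disp_t} {P : porderType d} {K : porderType d'} (N n : nat).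
Hypotheses (polyP : is_polytope P N) (polyK : is_polytope K n).
Variables (F : P) (f : P -> K).
Hypothesis rF : rk F = n.+1.
Hypothesis f_bij : set_bij [set H : P | (H <= F)%O] [set: K] f.
Hypothesis f_mono : {in [set H : P | (H <= F)%O] &, {mono f : G H / (G <= H)%O}}.

Let f_le G H : (G <= F)%O -> (H <= F)%O -> (f G <= f H)%O = (G <= H)%O.
Proof. by move=> GF HF; apply: f_mono; rewrite inE. Qed.

Let f_inj G H : (G <= F)%O -> (H <= F)%O -> f G = f H -> G = H.
Proof. by case: f_bij => _ inj _ GF HF; apply: inj; rewrite inE. Qed.

Let f_surj K0 : exists2 H, (H <= F)%O & f H = K0.
Proof. by case: f_bij => _ _ /(_ K0 I). Qed.

(* Taking F to be the maximum makes automorphisms a special case. *)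
Definition lower_part (Phi : set P) : set K := f @` [set H | Phi H /\ (H <= F)%O].

Lemma lower_part_flag Phi : is_flag Phi -> Phi F -> is_flag (lower_part Phi).
Proof.
move=> fP PF; split.
  move=> _ _ [G [PG GF] <-] [H [PH HF] <-]; rewrite !f_le//.
  exact: (flag_chain fP).
move=> Psi cPsi sub; apply/seteqP; split=> // K0 PK.
have [H HF eH] := f_surj K0; exists H => //; split=> //.
apply: flag_mem => // G PG; have [GF|FG] := chain_le1 (flag_chain fP) PG PF.
  rewrite -!(f_le HF (ltW GF)) -!(f_le (ltW GF) HF) eH.
  apply: cPsi => //; apply: sub; exists G => //; split=> //; exact: ltW.
by left; exact: le_trans FG.
Qed.

Lemma rk_lower H : (H <= F)%O -> rk (f H) = rk H.
Proof.
move=> HF; have [Phi fP sub] := chain_ext_flag (@chain_set2 _ _ H F HF).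
have PH : Phi H by apply: sub; left.
have PF : Phi F by apply: sub; right.
rewrite (rk_ncard polyP fP PH).
have fL := lower_part_flag fP PF.
rewrite (rk_ncard polyK fL); last by exists H.
apply: ncardE.
have -> : [set G | lower_part Phi G /\ (G < f H)%O] =
    f @` [set G | Phi G /\ (G < H)%O].
  apply/seteqP; split=> [_ [[G [PG GF] <-] GH]|_ [G [PG GH] <-]].
    by exists G => //; split=> //; move: GH; rewrite !lt_leAnge !f_le.
  have GF : (G <= F)%O := le_trans (ltW GH) HF.
  by split; [exists G|move: GH; rewrite !lt_leAnge !f_le].
apply: card_eq_trans; last first.
  apply: card_ncard; apply: sub_finite_set (flag_finite polyP fP) => G; exact: proj1.
apply: inj_card_eq => G1 G2; rewrite !inE => -[_ l1] [_ l2].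
by apply: f_inj; [exact: le_trans (ltW l1) HF|exact: le_trans (ltW l2) HF].
Qed.

Lemma lower_part_adj k Phi : k <= n -> is_flag Phi -> Phi F ->
  lower_part (adj N k Phi) = adj n k (lower_part Phi).
Proof.
move=> kn fP PF; have nN : n <= N by rewrite -ltnS -rF (rk_max polyP).
have [kN|kN] := boolP (0 < k <= n); last by rewrite !adj_id//; lia.
have kN' : 0 < k <= N by lia.
have fA := adj_flag polyP k fP.
have AF : adj N k Phi F by apply/(adj_face polyP); rewrite ?rF//; lia.
apply/esym/(adj_uniq polyK) => //; split; try exact: lower_part_flag.
  move=> e; apply: (adj_neq polyP fP kN'); apply: (flag_sub fA fP) => H AH.
  have [rH|/eqP rH] := eqVneq (rk H) k; last exact/(adj_face polyP fP rH).
  have HF : (H <= F)%O by rewrite (flag_rk_le polyP fA)// rF rH; lia.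
  have [G [PG GF] eG] : lower_part Phi (f H) by rewrite e; exists H.
  by rewrite -(f_inj GF HF eG).
move=> K0 rK.
have rk' H : (H <= F)%O -> f H = K0 -> rk H <> k by move=> HF eH; rewrite -rk_lower// eH.
split=> -[H [PH HF] eH]; exists H => //; split=> //.
  exact: (adj_face polyP fP (rk' _ HF eH)).2.
exact: (adj_face polyP fP (rk' _ HF eH)).1.
Qed.

Lemma lower_part_acts w Phi : all (fun k => k <= n) w -> is_flag Phi -> Phi F ->
  lower_part (acts (adj N) Phi w) = acts (adj n) (lower_part Phi) w.
Proof.
elim: w Phi => //= k w IH Phi /andP[kn wn] fP PF; rewrite IH ?lower_part_adj//.
  exact: adj_flag.
by apply/(adj_face polyP); rewrite ?rF//; lia.
Qed.

(** The restriction of [g] to the section below [F], conjugated by [f]; the map [e] of the proof is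
    the inverse of [f]. *)
Lemma facet_automorphism (g : P -> P) : is_automorphism g -> g F = F ->
  exists2 h : K -> K, is_automorphism h &
    forall Phi, h @` lower_part Phi = lower_part (g @` Phi).
Proof.
move=> [[g' gK g'K] g_mono] gF.
have g'F : g' F = F by rewrite -{1}gF gK.
have g_le H : (H <= F)%O -> (g H <= F)%O by move=> HF; rewrite -gF g_mono.
have g'_le H : (H <= F)%O -> (g' H <= F)%O.
  by move=> HF; rewrite -g_mono g'K gF.
have /boolp.choice[e eP] : forall x, exists y, (y <= F)%O /\ f y = x.
  by move=> x; have [H] := f_surj x; exists H.
have eF x : (e x <= F)%O by have [] := eP x.
have fe x : f (e x) = x by have [] := eP x.
have ef H : (H <= F)%O -> e (f H) = H by move=> HF; apply: f_inj => //; rewrite fe.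
exists (fun x => f (g (e x))).
  split; last by move=> x y; rewrite f_le ?g_le// g_mono -f_le// !fe.
  exists (fun x => f (g' (e x))) => x; rewrite ef ?g_le ?g'_le// ?gK ?g'K fe //.
move=> Phi; apply/seteqP; split=> [_ [_ [H [PH HF] <-] <-]|_ [_ [[H PH <-] HF] <-]].
  by rewrite ef//; exists (g H) => //; split; [exists H|exact: g_le].
have HF' : (H <= F)%O by rewrite -g_mono gF.
by exists (f H); [exists H|rewrite ef].
Qed.

End LowerSection.

(** * Automorphisms and flag orbits *)

Section Orbits.
Context {d : Order.disp_t} {P : porderType d} (N : nat).
Hypothesis polyP : is_polytope P N.
Implicit Types (Phi Psi : set P) (f : P -> P).

Lemma aut_inv f : is_automorphism f ->
  exists g, [/\ is_automorphism g, cancel f g & cancel g f].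
Proof.
move=> [[g fK gK] fm]; exists g; split=> //; split; first by exists f.
by move=> x y; rewrite -fm !gK.
Qed.

Lemma aut_lower_iso f : is_automorphism f -> exists T : P, [/\ rk T = N.+1,
  (forall H, (H <= T)%O), set_bij [set H : P | (H <= T)%O] [set: P] f &
  {in [set H : P | (H <= T)%O] &, {mono f : G H / (G <= H)%O}}].
Proof.
move=> [[g fK gK] fm]; case: (polyP) => -[_ [T Tmax]] _ _ _; exists T; split=> //.
- have [Phi fP _] := flag_through T.
  have [G PG rG] := flag_face_ex polyP fP (leqnn N.+1).
  by apply/eqP; rewrite eqn_leq (rk_max polyP) -{1}rG (rk_le polyP).
- split=> // [x y _ _ /(can_inj fK)//|x _]; exists (g x) => //; exact: Tmax.
Qed.

Let lower_top f T Phi : (forall H : P, (H <= T)%O) -> lower_part T f Phi = f @` Phi.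
Proof.
move=> Tmax; congr image; apply/seteqP; split=> [H []//|H PH].
by split=> //; exact: Tmax.
Qed.

Lemma aut_acts f Phi w : is_automorphism f -> is_flag Phi ->
  f @` (acts (adj N) Phi w) = acts (adj N) (f @` Phi) w.
Proof.
move=> af fP; have [T [rT Tmax fb fm]] := aut_lower_iso af.
pose v := [seq k <- w | k <= N].
have vw Psi : acts (adj N) Psi w = acts (adj N) Psi v.
  rewrite acts_filter // => k x kN; apply: adj_id.
  by apply: contra kN => /andP[].
rewrite !vw -!(lower_top _ _ Tmax); apply: lower_part_acts => //.
  exact: filter_all.
by apply: flag_mem => // H _; right; exact: Tmax.
Qed.

Lemma same_orbit_refl Phi : same_orbit Phi Phi.
Proof.
exists id; last by rewrite image_id.
by split=> //; exists id.
Qed.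

Lemma same_orbit_sym Phi Psi : same_orbit Phi Psi -> same_orbit Psi Phi.
Proof.
move=> [f /aut_inv[g [ag fK gK]] <-]; exists g => //.
by rewrite image_comp (_ : g \o f = id) ?image_id//; apply/funext.
Qed.

Lemma same_orbit_trans Phi Psi Om :
  same_orbit Phi Psi -> same_orbit Psi Om -> same_orbit Phi Om.
Proof.
move=> [f [bf fm] <-] [g [bg gm] <-]; exists (g \o f); last by rewrite image_comp.
by split; [exact: bij_comp|move=> x y /=; rewrite gm fm].
Qed.

Lemma same_orbit_acts Phi Psi w : is_flag Phi -> same_orbit Phi Psi ->
  same_orbit (acts (adj N) Phi w) (acts (adj N) Psi w).
Proof. by move=> fP [f af <-]; exists f => //; exact: aut_acts. Qed.

Hypothesis chiP : is_chiral P N.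

Lemma chiral_adj Phi k : is_flag Phi -> 0 < k <= N ->
  ~ same_orbit Phi (adj N k Phi).
Proof.
move=> fP kN; have /andP[k0 kN'] := kN; case: chiP => _; apply.
exists k.-1; first by rewrite prednK.
by apply/(flag_adjacent_atP polyP); rewrite prednK //; exact: adj_adj_rel.
Qed.

Lemma chiral_two_orbits Phi Psi Om : is_flag Phi -> is_flag Psi -> is_flag Om ->
  ~ same_orbit Phi Psi -> ~ same_orbit Psi Om -> same_orbit Phi Om.
Proof.
case: chiP => -[A [B [fA fB nAB cover]]] _ fP fQ fO nPQ nQO.
have sy := @same_orbit_sym; have tr := @same_orbit_trans.
have [] := cover _ fP; have [] := cover _ fQ; have [] := cover _ fO => hO hQ hP.
- by case: nPQ; apply: tr hQ; exact: sy.
- by case: nPQ; apply: tr hQ; exact: sy.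
- by apply: tr hO; exact: sy.
- by case: nQO; apply: tr hO; exact: sy.
- by case: nQO; apply: tr hO; exact: sy.
- by apply: tr hO; exact: sy.
- by case: nPQ; apply: tr hQ; exact: sy.
- by case: nPQ; apply: tr hQ; exact: sy.
Qed.

(** Letters outside 1, ..., [N] do not move a flag, so they are not counted. *)
Definition parity (w : seq nat) := odd (count (fun k => 0 < k <= N) w).

(** Each counted letter switches between the two orbits. *)
Lemma chiral_parity Phi w : is_flag Phi ->
  same_orbit Phi (acts (adj N) Phi w) <-> ~~ parity w.
Proof.
move=> fP; elim/last_ind: w => [|w k IH].
  by split=> // _; exact: same_orbit_refl.
rewrite -cats1 acts_cat /= /parity count_cat /= addn0 oddD.
have [kN|kN] := boolP (0 < k <= N); last by rewrite adj_id // addbF.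
rewrite addbT negbK; have fW := acts_flag polyP w fP.
have nW := chiral_adj fW kN; split=> [h|h].
  apply: contrapT => /negP/IH h'; apply: nW.
  exact: same_orbit_trans (same_orbit_sym h') h.
apply: chiral_two_orbits nW => //; first exact: adj_flag.
by move/IH; rewrite /parity h.
Qed.

End Orbits.

(** * Sections that are polygons *)

Section Isomorphisms.
Context {d d' : Order.disp_t} {P : porderType d} {Q : porderType d'}.

Lemma isomorphic_of_embedding (A : set P) (g : Q -> P) (x0 : Q) :
  (forall x, A (g x)) -> (forall H, A H -> exists x, g x = H) ->
  {mono g : x y / (x <= y)%O} -> isomorphic_subposets A [set: Q].
Proof.
move=> Ag gA gm.
have g_inj : injective g.
  by move=> x y e; apply: le_anti; rewrite -!gm e lexx.
pose f H := xget x0 [set x | g x = H].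
have gf H : A H -> g (f H) = H.
  by move=> /gA ex; rewrite /f; apply: (xgetPex x0 ex).
exists f; last first.
  by move=> x y; rewrite !inE => Ax Ay; rewrite -gm !gf.
split=> // [x y|x _].
  by rewrite !inE => Ax Ay e; rewrite -(gf _ Ax) e gf.
by exists (g x); [exact: Ag|apply: g_inj; rewrite gf].
Qed.

Lemma isomorphic_card (A : set P) (B : set Q) : isomorphic_subposets A B -> A #= B.
Proof.
move=> [f [fAB f_inj f_surj] _]; have <- : f @` A = B.
  by apply/seteqP; split=> [_ [x Ax <-]|y /f_surj//]; exact: fAB.
exact/card_esym/inj_card_eq.
Qed.

Lemma isomorphic_trans {d'' : Order.disp_t} {S : porderType d''}
    (A : set P) (B : set Q) (C : set S) :
  isomorphic_subposets A B -> isomorphic_subposets B C -> isomorphic_subposets A C.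
Proof.
move=> [f fAB fm] [g gBC gm]; have [fB f_inj f_surj] := fAB.
have [gC g_inj g_surj] := gBC; exists (g \o f).
  split=> [x Ax|x y|z /g_surj[y By <-]].
  - exact/gC/fB.
  - rewrite !inE => Ax Ay /= e; apply: f_inj; rewrite ?inE//.
    by apply: g_inj; rewrite ?inE//; exact: fB.
  - by have [x Ax <-] := f_surj _ By; exists x.
move=> x y; rewrite !inE => Ax Ay /=.
by rewrite gm ?fm ?inE//; exact: fB.
Qed.

End Isomorphisms.

(** * The length of a polygon *)

Section GonUnique.
Context {d : Order.disp_t} {P : porderType d}.

Lemma polygon_card (k : nat) : [set: polygon (@ordS k)] #= `I_(k + k).+2.
Proof.
have -> : (k + k).+2 = #|{: option (option ('I_k + 'I_k))}|.
  by rewrite !card_option card_sum !card_ord.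
apply: card_eq_trans (card_esym card_II).
apply/card_bijP.
have bij : bijective (enum_rank \o @polygon_encode _ (@ordS k)).
  apply: bij_comp; first exact: enum_rank_bij.
  exists (@polygon_decode _ (@ordS k)); first exact: polygon_encodeK.
  by case=> [[[i|i]|]|].
have [h hK Kh] := bij.
exists (fun x => SigSub (mem_set (I : [set: _] (enum_rank (polygon_encode (val x)))))).
exists (fun x => SigSub (mem_set (I : [set: _] (h (val x))))) => x.
  by apply: val_inj => /=; exact: hK.
by apply: val_inj => /=; exact: Kh.
Qed.

Lemma polygon_int_infinite :
  infinite_set [set: polygon (fun z : int => z + 1)%R].
Proof.
move=> fin; apply: infinite_nat.
pose g (k : nat) := PolyVertex (fun z : int => z + 1)%R (Posz k).
have g_inj : {in [set: nat] &, injective g} by move=> x y _ _ [].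
apply: sub_finite_set (subsetT _) _ => //.
rewrite -(eq_finite_set (inj_card_eq g_inj)).
exact: sub_finite_set fin.
Qed.

(** A polygon with [k] vertices has 2k + 2 faces and the infinite one infinitely many, so
    cardinality decides. *)
Lemma is_gon_unique (A : set P) p q : is_gon A p -> is_gon A q -> p = q.
Proof.
case: p q => [k|] [l|] //=.
- move=> [_ /isomorphic_card Ak] [_ /isomorphic_card Al].
  have := card_II_inj (card_eq_trans Ak (polygon_card k))
    (card_eq_trans Al (polygon_card l)).
  by move=> e; congr Some; lia.
- move=> [_ /isomorphic_card Ak] /isomorphic_card Ai; exfalso.
  apply: polygon_int_infinite; rewrite -(eq_finite_set Ai).
  by apply/finite_setP; exists (k + k).+2; exact: card_eq_trans (polygon_card k).
- move=> /isomorphic_card Ai [_ /isomorphic_card Ak]; exfalso.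
  apply: polygon_int_infinite; rewrite -(eq_finite_set Ai).
  by apply/finite_setP; exists (l + l).+2; exact: card_eq_trans (polygon_card l).
Qed.

End GonUnique.

Lemma polygon_leE (I : choiceType) (s : I -> I) (x y : polygon s) :
  (x <= y)%O = polygon_le x y.
Proof. by []. Qed.

(** * Recognising a polygon from an enumeration of its flags *)

Section PolygonSection.
Context {d : Order.disp_t} {P : porderType d} (N : nat).
Hypothesis polyP : is_polytope P N.
Variables (Phi : set P) (F G : P) (i : nat).
Hypotheses (fP : is_flag Phi) (PF : Phi F) (PG : Phi G).
Hypotheses (rF : rk F = i) (rG : rk G = i.+3).

Let iN : i.+1 < N.
Proof. by have := rk_max polyP G; rewrite rG. Qed.

Lemma flag_agree k (Psi : set P) : 0 < k <= N -> is_flag Psi -> forall Om, is_flag Om ->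
  (forall H, rk H <> k -> Psi H -> Om H) -> Om = Psi \/ Om = adj N k Psi.
Proof.
move=> kN fPsi Om fO ag; case: (pselect (Om = Psi)) => [|ne]; [by left|right].
apply/esym/(adj_uniq polyP) => //; split=> // [e|H rH]; first exact: ne.
split=> [|OH]; first exact: ag.
have [H' QH' rH'] := flag_face_ex polyP fPsi (rk_max polyP H).
by rewrite -(flag_rk_inj polyP fO _ OH rH')//; apply: ag; rewrite // rH'.
Qed.

(** The chain is completed to a flag by the faces of [Phi] of rank at most [i] or at least [i.+3]. A
    word leading there from [Phi] avoids the ranks of these common faces, which leaves [i.+1] and
    [i.+2]. *)
Lemma section_chain_flag C : chain C -> C `<=` section F G ->
  exists w, all (pred2 i.+1 i.+2) w /\ forall H, C H -> acts (adj N) Phi w H.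
Proof.
move=> cC sub.
have cD : chain (C `|` [set H | Phi H /\ (rk H <= i \/ i.+3 <= rk H)]).
  have cmp H1 H2 : C H1 -> Phi H2 -> (rk H2 <= i \/ i.+3 <= rk H2) ->
      (H1 <= H2)%O \/ (H2 <= H1)%O.
    move=> /sub/andP[FH HG] PH2 [r2|r2].
      by right; apply: le_trans FH; rewrite (flag_rk_le polyP fP)// rF.
    by left; apply: le_trans HG _; rewrite (flag_rk_le polyP fP)// rG.
  move=> H1 H2 [C1|[P1 r1]] [C2|[P2 r2]].
  - exact: cC.
  - exact: cmp.
  - by have [] := cmp _ _ C2 P1 r1; auto.
  - exact: (flag_chain fP).
have [Psi fQ subQ] := chain_ext_flag cD.
have [w [ew aw rw]] := flag_connect polyP fP fQ.
exists w; split; last by move=> H CH; rewrite ew; apply: subQ; left.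
apply/allP => k kw; have kN := allP aw k kw; apply/negPn/negP => /= kn.
have [H PH rH] : exists2 H, Phi H & rk H = k by apply: (flag_face_ex polyP fP); lia.
suff /(rw H PH) : Psi H by rewrite rH kw.
apply: subQ; right; split=> //.
by rewrite rH; lia.
Qed.

(** [psi] lists every other flag around the section, [s] being one step of the rotation. The flags
    in between are the [i.+1]-neighbours; [psi_alt] keeps the two kinds apart. *)
Variables (I : choiceType) (s : I -> I) (psi : I -> set P).
Hypothesis psiP : forall j,
  exists2 w, all (pred2 i.+1 i.+2) w & psi j = acts (adj N) Phi w.
Hypothesis psi_inj : injective psi.
Hypothesis psiS : forall j, psi (s j) = adj N i.+2 (adj N i.+1 (psi j)).
Hypothesis s_surj : forall j, exists k, s k = j.
Hypothesis psi_base : exists j, psi j = Phi.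
Hypothesis psi_alt : forall j k, psi j <> adj N i.+1 (psi k).

Let fpsi j : is_flag (psi j).
Proof. by have [w _ ->] := psiP j; exact: acts_flag. Qed.

Let fpsia j : is_flag (adj N i.+1 (psi j)).
Proof. exact: adj_flag. Qed.

Let psi_out j H : rk H <= i \/ i.+3 <= rk H -> psi j H <-> Phi H.
Proof.
move=> rH; have [w aw ->] := psiP j; apply: acts_face => //.
by apply/negP => /(allP aw) /=; lia.
Qed.

Let orbitE w : all (pred2 i.+1 i.+2) w ->
  exists j, acts (adj N) Phi w = psi j \/ acts (adj N) Phi w = adj N i.+1 (psi j).
Proof.
elim/last_ind: w => [|w k IH]; first by have [j <-] := psi_base; exists j; left.
rewrite all_rcons => /andP[/orP[]/eqP-> /IH[j ej]]; rewrite -cats1 acts_cat /=.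
  by case: ej => ->; exists j; [right|left; rewrite adjK].
case: ej => ->; last by exists (s j); left.
have [l <-] := s_surj j; exists l; right.
by rewrite psiS adjK//.
Qed.

Let fc k j : P := xget F [set H | psi j H /\ rk H = k].

Let fcP k j : k <= N.+1 -> psi j (fc k j) /\ rk (fc k j) = k.
Proof.
move=> kN; have [H QH rH] := flag_face_ex polyP (fpsi j) kN.
by apply: (@xgetPex _ F [set H | psi j H /\ rk H = k]); exists H.
Qed.

Let v := fc i.+1.
Let e := fc i.+2.

Let vP j : psi j (v j). Proof. by apply: (fcP _ _).1; lia. Qed.
Let rv j : rk (v j) = i.+1. Proof. by apply: (fcP _ _).2; lia. Qed.
Let eP j : psi j (e j). Proof. by apply: (fcP _ _).1; lia. Qed.
Let re j : rk (e j) = i.+2. Proof. by apply: (fcP _ _).2; lia. Qed.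
Let Fpsi j : psi j F. Proof. by apply/psi_out; rewrite ?rF; [left|]. Qed.
Let Gpsi j : psi j G. Proof. by apply/psi_out; rewrite ?rG; [right|]. Qed.

(** The rank of [A] is the one of [i.+1], [i.+2] other than [k], so two listed flags through [A] can
    differ at rank [k] only. *)
Let psi_share k j l A : rk A = i.+1 + i.+2 - k -> k = i.+1 \/ k = i.+2 ->
  psi j A -> psi l A -> psi l = psi j \/ psi l = adj N k (psi j).
Proof.
move=> rA kE jA lA; apply: flag_agree => //; first by lia.
move=> H rH jH; have [rHA|/eqP rHA] := eqVneq (rk H) (rk A).
  by rewrite (flag_rk_inj polyP (fpsi j) jH jA).
by apply/psi_out; [lia|]; apply/(@psi_out j); [lia|].
Qed.

Let v_inj j l : psi l (v j) -> j = l.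
Proof.
move=> lv; have [||||/psi_inj//|] := @psi_share i.+2 j l (v j) _ _ _ _ => //.
- by rewrite rv; lia.
- by right.
(* The [i.+2]-neighbour of [psi (s m)] is the [i.+1]-neighbour of [psi m], which is not in the
   list. *)
have [m <-] := s_surj j; rewrite psiS adjK// => h.
by case: (psi_alt h).
Qed.

Let e_inj j l : psi l (e j) -> j = l.
Proof.
move=> le; have [||||/psi_inj//|] := @psi_share i.+1 j l (e j) _ _ _ _ => //.
- by rewrite re; lia.
- by left.
by move=> h; case: (psi_alt h).
Qed.

Let alt_v j H : rk H = i.+1 -> adj N i.+1 (psi j) H -> H = v (s j).
Proof.
move=> rH aH; apply: (flag_rk_inj polyP (fpsi (s j))) => //; last by rewrite rv.
by rewrite psiS; apply/(adj_face polyP) => //; rewrite rH; lia.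
Qed.

Let alt_e j H : rk H = i.+2 -> adj N i.+1 (psi j) H -> H = e j.
Proof.
move=> rH aH; apply: (flag_rk_inj polyP (fpsi j)) => //; last by rewrite re.
by move: aH; rewrite (adj_face polyP)//; lia.
Qed.

(** An incident pair lies on a flag that is [psi m] or its [i.+1]-neighbour. The former gives [j] =
    [l] = [m], the latter [l] = [m] and [j] = [s m]. *)
Let v_le_e j l : (v j <= e l)%O = (j == l) || (j == s l).
Proof.
apply/idP/orP => [le|[]/eqP->]; first 1 last.
- by rewrite (flag_rk_le polyP (fpsi l))// rv re.
- have [av ae] : adj N i.+1 (psi l) (v (s l)) /\ adj N i.+1 (psi l) (e l).
    split; last by apply/(adj_face polyP) => //; rewrite re; lia.
    have := vP (s l); rewrite psiS (adj_face polyP) //; rewrite rv; lia.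
  by rewrite (flag_rk_le polyP (fpsia l))// rv re.
have [||w [aw wP]] := @section_chain_flag [set v j; e l].
- exact: chain_set2.
- move=> _ [->|->]; rewrite /section /=.
    by rewrite !(flag_rk_le polyP (fpsi j))// rv rF rG; lia.
  by rewrite !(flag_rk_le polyP (fpsi l))// re rF rG; lia.
have wv := wP _ (or_introl erefl); have we := wP _ (or_intror erefl).
have [m [em|em]] := orbitE aw; rewrite em in wv we.
  by left; rewrite (v_inj wv) (e_inj we).
have el : l = m.
  apply: e_inj; move: we; rewrite (adj_face polyP)// re; lia.
right; rewrite el; apply/eqP/v_inj; rewrite psiS.
by apply/(adj_face polyP) => //; rewrite rv; lia.
Qed.

Let emb (x : polygon s) : P :=
  match x with
  | PolyBot => F | PolyTop => G | PolyVertex j => v j | PolyEdge j => e j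
  end.

Let eq_rk_le (H1 H2 : P) : rk H1 = rk H2 -> (H1 <= H2)%O = (H1 == H2).
Proof.
move=> r12; rewrite le_eqVlt; case: eqVneq => //= _.
by apply/negP => /(rk_lt polyP); rewrite r12 ltnn.
Qed.

Let gt_rk_le (H1 H2 : P) : rk H2 < rk H1 -> (H1 <= H2)%O = false.
Proof. by move=> r12; apply/negP => /(rk_le polyP); rewrite leqNgt r12. Qed.

Lemma polygon_section : isomorphic_subposets (section F G) [set: polygon s].
Proof.
have [j0 _] := psi_base.
apply: (@isomorphic_of_embedding _ _ P (polygon s) (section F G) emb (PolyBot s)).
- case=> [|j|j|]; rewrite /section /=.
  + by rewrite lexx (flag_rk_le polyP fP)// rF rG; lia.
  + by rewrite !(flag_rk_le polyP (fpsi j))// rF rG rv; lia.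
  + by rewrite !(flag_rk_le polyP (fpsi j))// rF rG re; lia.
  + by rewrite lexx (flag_rk_le polyP fP)// rF rG; lia.
- move=> H /andP[FH HG].
  move: FH; rewrite le_eqVlt => /orP[/eqP<-|FH]; first by exists (PolyBot s).
  move: HG; rewrite le_eqVlt => /orP[/eqP->|HG]; first by exists (PolyTop s).
  have [||w [aw wP]] := @section_chain_flag [set H].
  + exact: chain_set1.
  + by move=> _ ->; rewrite /section /= !ltW.
  have {}wP := wP _ erefl.
  have [rH|rH] : rk H = i.+1 \/ rk H = i.+2.
    by have := rk_lt polyP FH; have := rk_lt polyP HG; rewrite rF rG; lia.
    have [j [ej|ej]] := orbitE aw; rewrite ej in wP.
      exists (PolyVertex s j); apply: (flag_rk_inj polyP (fpsi j)) => //=.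
      by rewrite rv.
    by exists (PolyVertex s (s j)); rewrite (alt_v rH wP).
  have [j [ej|ej]] := orbitE aw; rewrite ej in wP.
    exists (PolyEdge s j); apply: (flag_rk_inj polyP (fpsi j)) => //=.
    by rewrite re.
  by exists (PolyEdge s j); rewrite (alt_e rH wP).
move=> x y; rewrite polygon_leE; case: x y => [|j|j|] [|l|l|] /=.
all: rewrite ?lexx ?v_le_e //.
all: try by rewrite gt_rk_le ?rF ?rG ?rv ?re; lia.
all: try by rewrite (flag_rk_le polyP fP)// ?rF ?rG; lia.
all: try by rewrite (flag_rk_le polyP (fpsi j))// ?rF ?rG ?rv ?re; lia.
all: try by rewrite (flag_rk_le polyP (fpsi l))// ?rF ?rG ?rv ?re; lia.
- rewrite eq_rk_le ?rv//; apply/eqP/eqP => [ev|->]//.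
  by apply: v_inj; rewrite ev.
- rewrite eq_rk_le ?re//; apply/eqP/eqP => [ev|->]//.
  by apply: e_inj; rewrite ev.
Qed.

End PolygonSection.

Definition rot_word i m := flatten (nseq m [:: i.+1; i.+2]).

Lemma acts_rot_word (T : Type) (a : nat -> T -> T) x i m :
  acts a x (rot_word i m) = iter m (fun y => a i.+2 (a i.+1 y)) x.
Proof. by elim: m x => //= m IH x; rewrite [LHS]IH -iterSr. Qed.

(** * Entries of the type as orders of rotations *)

Section PolygonOrder.
Context {d : Order.disp_t} {P : porderType d} (N : nat).
Hypothesis polyP : is_polytope P N.
Variables (i : nat).

Definition rot (Phi : set P) := adj N i.+2 (adj N i.+1 Phi).
Let rotV (Phi : set P) := adj N i.+1 (adj N i.+2 Phi).

Lemma rot_flag Phi m : is_flag Phi -> is_flag (iter m rot Phi).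
Proof. by move=> fP; elim: m => //= m IH; exact/(adj_flag polyP)/(adj_flag polyP). Qed.

Let rotV_flag Phi m : is_flag Phi -> is_flag (iter m rotV Phi).
Proof. by move=> fP; elim: m => //= m IH; exact/(adj_flag polyP)/(adj_flag polyP). Qed.

Let rotK Phi : is_flag Phi -> rotV (rot Phi) = Phi.
Proof. by move=> fP; rewrite /rotV /rot !adjK//; exact: adj_flag. Qed.

Let rotVK Phi : is_flag Phi -> rot (rotV Phi) = Phi.
Proof. by move=> fP; rewrite /rotV /rot !adjK//; exact: adj_flag. Qed.

Let rotV_word m := flatten (nseq m [:: i.+2; i.+1]).

Lemma rot_wordE m Phi : iter m rot Phi = acts (adj N) Phi (rot_word i m).
Proof. by rewrite acts_rot_word. Qed.

Let rotV_wordE m Phi : iter m rotV Phi = acts (adj N) Phi (rotV_word m).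
Proof. by elim: m Phi => //= m IH Phi; rewrite -IH -iterSr. Qed.

Lemma rot_word_all m : all (pred2 i.+1 i.+2) (rot_word i m).
Proof. by elim: m => //= m ->; rewrite !eqxx orbT. Qed.

Let rotV_word_all m : all (pred2 i.+1 i.+2) (rotV_word m).
Proof. by elim: m => //= m ->; rewrite !eqxx orbT. Qed.

Lemma rot_word_size m : odd (size (rot_word i m)) = false.
Proof. by elim: m => //= m ->. Qed.

Let rotV_word_size m : odd (size (rotV_word m)) = false.
Proof. by elim: m => //= m ->. Qed.

Variables (Phi : set P) (F G : P).
Hypotheses (fP : is_flag Phi) (PF : Phi F) (PG : Phi G).
Hypotheses (rF : rk F = i) (rG : rk G = i.+3).
(** For chiral polytopes this is [chiral_orientable]. It separates rotations from reflections, as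
    [psi_alt] requires. *)
Hypothesis orientable : forall v w, all (pred2 i.+1 i.+2) v ->
  all (pred2 i.+1 i.+2) w -> acts (adj N) Phi v = acts (adj N) Phi w ->
  odd (size v) = odd (size w).

Let rot_cancel a b : iter (a + b) rot Phi = iter a rot Phi -> iter b rot Phi = Phi.
Proof.
elim: a => //= a IH e; apply: IH.
by rewrite -(rotK (rot_flag (a + b) fP)) e rotK//; exact: rot_flag.
Qed.

Let rot_iter_inj (per : nat -> bool) :
  (forall m, iter m rot Phi = Phi <-> per m) -> forall a b,
  iter a rot Phi = iter b rot Phi -> (a <= b -> per (b - a)) /\ (b <= a -> per (a - b)).
Proof.
move=> perP a b e; split=> ab; apply/perP.
  by apply: (@rot_cancel a); rewrite subnKC.
by apply: (@rot_cancel b); rewrite subnKC.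
Qed.

(** Excludes order 1, as the entries of a type are at least 2. *)
Let rot_neq : rot Phi <> Phi.
Proof.
have iN := rk_max polyP G; rewrite rG in iN.
move=> e; have /(congr1 rotV) := e; rewrite rotK// /rotV => e2.
have {}e2 : adj N i.+1 Phi = adj N i.+2 Phi by rewrite {1}e2 adjK//; exact: adj_flag.
have kN : 0 < i.+1 <= N by lia.
have fA := adj_flag polyP i.+1 fP.
apply: (adj_neq polyP fP kN); apply: (flag_sub fA fP) => H AH.
have [rH|/eqP rH] := eqVneq (rk H) i.+1; last exact/(adj_face polyP fP rH).
by move: AH; rewrite e2 (adj_face polyP)// rH; lia.
Qed.

Lemma gon_of_order_fin k : 0 < k -> (forall m, iter m rot Phi = Phi <-> k %| m) ->
  is_gon (section F G) (Some k).
Proof.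
move=> k0 per; split.
  by case: k k0 per => [//|[|k]] // _ /(_ 1)[_ /(_ isT)] /rot_neq.
have iter_mod m : iter m rot Phi = iter (m %% k) rot Phi.
  rewrite {1}(divn_eq m k) addnC iterD; congr iter; apply/per.
  exact: dvdn_mull.
apply: (@polygon_section _ _ N polyP Phi F G i fP PF PG rF rG _ _
  (fun j : 'I_k => iter j rot Phi)).
- by move=> j; exists (rot_word i j); [exact: rot_word_all|exact: rot_wordE].
- move=> j l /(rot_iter_inj per)[h1 h2]; apply: val_inj => /=.
  have jk := ltn_ord j; have lk := ltn_ord l.
  case: (leqP j l) => jl.
    by have : 0 < l - j -> k <= l - j := fun H => dvdn_leq H (h1 jl); lia.
  by have : 0 < j - l -> k <= j - l := fun H => dvdn_leq H (h2 (ltnW jl)); lia.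
- by move=> j /=; rewrite -iter_mod.
- by move=> j; exists (ord_pred j); rewrite ord_predK.
- by exists (Ordinal k0).
- move=> j l /=; rewrite !rot_wordE.
  rewrite -[adj N i.+1 _]/(acts (adj N) _ [:: i.+1]) -acts_cat => /orientable.
  rewrite all_cat !rot_word_all /= eqxx => /(_ isT isT).
  by rewrite size_cat oddD !rot_word_size.
Qed.

Lemma gon_of_order_inf : (forall m, iter m rot Phi = Phi <-> m == 0) ->
  is_gon (section F G) None.
Proof.
move=> per.
(* [Negz m] is -(m + 1), hence the exponent [m.+1]. *)
pose psi (z : int) := match z with
  | Posz m => iter m rot Phi | Negz m => iter m.+1 rotV Phi end.
have psiP z : exists w, [/\ all (pred2 i.+1 i.+2) w, odd (size w) = false &
    psi z = acts (adj N) Phi w].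
  case: z => m.
    by exists (rot_word i m); split; [exact: rot_word_all|exact: rot_word_size|exact: rot_wordE].
  exists (rotV_word m.+1); split; [exact: rotV_word_all|exact: rotV_word_size|].
  exact: rotV_wordE.
have psiS z : psi (z + 1)%R = rot (psi z).
  case: z => [m|[|m]].
  - by rewrite (_ : (Posz m + 1)%R = Posz m.+1); [|lia].
  - by rewrite (_ : (Negz 0 + 1)%R = Posz 0); [rewrite /= rotVK|lia].
  - rewrite (_ : (Negz m.+1 + 1)%R = Negz m); last by lia.
    by rewrite [in RHS]/psi iterS rotVK//; exact: rotV_flag.
have psiD z m : psi (z + Posz m)%R = iter m rot (psi z).
  elim: m => [|m IH]; first by rewrite GRing.addr0.
  by rewrite (_ : (z + Posz m.+1 = (z + Posz m) + 1)%R); [rewrite psiS IH|lia].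
apply: (@polygon_section _ _ N polyP Phi F G i fP PF PG rF rG _ _ psi).
- by move=> z; have [w [? _ ?]] := psiP z; exists w.
- move=> y z e.
  (* Translation by a common [a] makes both indices nonnegative. *)
  have [a [b [c [ea eb]]]] : exists a b c : nat,
      (y + Posz a)%R = Posz b /\ (z + Posz a)%R = Posz c.
    exists (absz y + absz z), (absz (y + Posz (absz y + absz z)%N)%R).
    by exists (absz (z + Posz (absz y + absz z)%N)%R); lia.
  have : psi (Posz b) = psi (Posz c) by rewrite -ea -eb !psiD e.
  move=> /(rot_iter_inj per)[h1 h2].
  by have [/h1|/ltnW/h2] := leqP b c => /eqP; lia.
- exact: psiS.
- by move=> z; exists (z - 1)%R; lia.
- by exists (Posz 0).
- move=> y z; have [v [av sv ->]] := psiP y; have [w [aw sw ->]] := psiP z.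
  rewrite -[adj N i.+1 _]/(acts (adj N) _ [:: i.+1]) -acts_cat => /orientable.
  by rewrite all_cat av aw /= eqxx size_cat oddD sv sw => /(_ isT isT).
Qed.

(* [odflt 0] sends oo to 0, whose only multiple is 0. *)
Lemma gon_of_order p : p <> Some 0 ->
  (forall m, iter m rot Phi = Phi <-> odflt 0 p %| m) -> is_gon (section F G) p.
Proof.
case: p => [k|] p0 per; first by apply: gon_of_order_fin => //; case: k p0 per.
by apply: gon_of_order_inf => m; rewrite per /= dvd0n.
Qed.

(** The rotation has some order, finite or not, which makes the section a polygon of that length;
    uniqueness of the length identifies it with [p]. *)
Lemma order_of_gon p : is_gon (section F G) p ->
  forall m, iter m rot Phi = Phi <-> odflt 0 p %| m.
Proof.
move=> gp; case: (pselect (exists m, (0 < m) && `[< iter m rot Phi = Phi >])).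
  move=> ex; case: (ex_minnP ex) => k /andP[k0 /asboolP ek] kmin.
  have per m : iter m rot Phi = Phi <-> k %| m.
    have emul j : iter (j * k) rot Phi = Phi.
      by elim: j => //= j IH; rewrite mulSn iterD IH.
    split=> [em|/dvdnP[j ->]]; last exact: emul.
    have er : iter (m %% k) rot Phi = Phi.
      apply: (@rot_cancel (m %/ k * k)); rewrite -divn_eq em emul//.
    rewrite /dvdn; apply: contraT; rewrite -lt0n => r0.
    have := kmin (m %% k); rewrite r0 asboolT//= => /(_ isT).
    by rewrite leqNgt ltn_mod k0.
  by rewrite (is_gon_unique gp (gon_of_order_fin k0 per)).
move=> nex; have per m : iter m rot Phi = Phi <-> m == 0.
  split=> [em|/eqP->//]; rewrite -leqn0 leqNgt; apply/negP => m0.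
  by apply: nex; exists m; rewrite m0 asboolT.
by move=> m; rewrite (is_gon_unique gp (gon_of_order_inf per)) /= dvd0n; exact: per.
Qed.

End PolygonOrder.

(** * Twisting a regular maniplex *)

Section RegularManiplex.
Variables (n : nat) (R : colgraph n).
Hypothesis regR : is_regular_maniplex R.

Let manR : is_maniplex R := regR.1.
Implicit Types (u v : R) (k l : nat).

Lemma neighbor_subproof :
  { f : 'I_n * R -> R | forall iv, edge iv.1 iv.2 (f iv) }.
Proof.
apply: cid; have /boolp.choice[f fP] : forall iv : 'I_n * R, exists w, edge iv.1 iv.2 w.
  by move=> [i v]; have [w [ew _]] := maniplex_matching manR i v; exists w.
by exists f.
Qed.

(* Colours are shifted by one, so as to match the shifted ranks. *)
Definition nbr k v : R :=
  if k is k'.+1 then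
    if insub k' is Some i then sval neighbor_subproof (i, v) else v
  else v.

Lemma nbr_id k v : ~~ (0 < k <= n) -> nbr k v = v.
Proof. by case: k => //= k kn; rewrite insubN. Qed.

Lemma nbr_edge (i : 'I_n) v : edge i v (nbr i.+1 v).
Proof. by rewrite /nbr valK; exact: (svalP neighbor_subproof (i, v)). Qed.

Lemma nbrE (i : 'I_n) u v : edge i u v -> v = nbr i.+1 u.
Proof.
move=> e; have [w [_ uw]] := maniplex_matching manR i u.
by rewrite -(uw _ e); apply: uw; exact: nbr_edge.
Qed.

Lemma nbr_ord k : 0 < k <= n -> exists i : 'I_n, k = i.+1.
Proof. by case: k => //= k kn; exists (Ordinal kn). Qed.

Lemma nbrK k : involutive (nbr k).
Proof.
move=> v; have [/nbr_ord[i ->]|kn] := boolP (0 < k <= n); last by rewrite !nbr_id.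
by apply/esym/nbrE/(maniplex_sym manR)/nbr_edge.
Qed.

Lemma nbrC k l v : k.+1 < l -> nbr k (nbr l v) = nbr l (nbr k v).
Proof.
move=> kl; have [/nbr_ord[i ei]|kn] := boolP (0 < k <= n); last by rewrite !(nbr_id _ kn).
have [/nbr_ord[j ej]|ln] := boolP (0 < l <= n); last by rewrite !(nbr_id _ ln).
subst k l; have [|v1 [v2 [v3 [_ [e1 e2 e3 e4] _]]]] := @maniplex_4cycles _ _ manR i j v.
  by left; lia.
rewrite -(nbrE e1) -(nbrE e2).
rewrite -(nbrE (maniplex_sym manR e4)).
by rewrite -(nbrE (maniplex_sym manR e3)).
Qed.

Lemma linked_acts (C : set 'I_n) u v : linked C u v -> exists w, acts nbr u w = v.
Proof.
elim=> [x y [i _ /nbrE->]|x|x y z _ [w1 <-] _ [w2 <-]].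
- by exists [:: i.+1].
- by exists [::].
- by exists (w1 ++ w2); rewrite acts_cat.
Qed.

Lemma nbr_connect u v : exists w, acts nbr u w = v.
Proof. exact: linked_acts (maniplex_connected manR u v). Qed.

Lemma graph_aut_nbr (f : R -> R) : is_graph_automorphism f ->
  forall k v, f (nbr k v) = nbr k (f v).
Proof.
move=> [_ fe] k v; have [/nbr_ord[i ->]|kn] := boolP (0 < k <= n); last by rewrite !nbr_id.
by apply: nbrE; apply: (fe _ _ _).1; exact: nbr_edge.
Qed.

Lemma graph_aut_acts (f : R -> R) w v : is_graph_automorphism f ->
  f (acts nbr v w) = acts nbr (f v) w.
Proof. by move=> af; elim: w v => //= k w IH v; rewrite IH graph_aut_nbr. Qed.

Lemma commuting_nbr_eq (f g : R -> R) v :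
  (forall k u, f (nbr k u) = nbr k (f u)) ->
  (forall k u, g (nbr k u) = nbr k (g u)) -> f v = g v -> f =1 g.
Proof.
move=> fn gn e u; have [w <-] := nbr_connect v u.
by elim/last_ind: w => [//|w k IH]; rewrite -cats1 acts_cat /= fn gn IH.
Qed.

(** By regularity an automorphism carries [u] to [v], and it commutes with words. *)
Lemma acts_nbr_fix u v w : acts nbr u w = u -> acts nbr v w = v.
Proof.
move=> e; have [f af <-] := regR.2 u v.
by rewrite -graph_aut_acts // e.
Qed.

Lemma same_facet_trans u v x : same_facet u v -> same_facet v x -> same_facet u x.
Proof. exact: rt_trans. Qed.

Lemma same_facet_nbr k v : k < n -> same_facet v (nbr k v).
Proof.
move=> kn; have [/nbr_ord[i ei]|kn'] := boolP (0 < k <= n); last first.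
  by rewrite nbr_id//; exact: rt_refl.
by subst k; apply: rt_step; exists i => //; exact: nbr_edge.
Qed.

Lemma same_facet_aut (f : R -> R) u v : is_graph_automorphism f ->
  same_facet u v -> same_facet (f u) (f v).
Proof.
move=> [_ fe]; elim=> [x y [i iC e]|x|x y z _ h1 _ h2].
- by apply: rt_step; exists i => //; exact: (fe _ _ _).1.
- exact: rt_refl.
- exact: rt_trans h1 h2.
Qed.

Hypothesis twoR : at_least_two_facets R.

(** If one edge of the last colour stayed within a facet, regularity would give the same at every
    flag, and [R] would have a single facet. *)
Lemma not_same_facet_nbr v : ~ same_facet v (nbr n v).
Proof.
move=> sf; have [x [y]] := twoR; apply.
have sfn u : same_facet u (nbr n u).
  have [f af <-] := regR.2 v u; rewrite -graph_aut_nbr //.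
  exact: same_facet_aut.
have [w <-] := nbr_connect x y; elim/last_ind: w => [|w k IH]; first exact: rt_refl.
rewrite -cats1 acts_cat /=; apply: same_facet_trans IH _.
have [|nk] := ltnP k n; first exact: same_facet_nbr.
have [->|kn] := eqVneq k n; first exact: sfn.
by rewrite nbr_id; [exact: rt_refl|lia].
Qed.

Variable v0 : R.

Lemma base_aut_subproof :
  { f : nat -> R -> R | forall k, is_graph_automorphism (f k) /\ f k v0 = nbr k v0 }.
Proof.
apply: cid.
have /boolp.choice : forall k, exists f : R -> R,
    is_graph_automorphism f /\ f v0 = nbr k v0.
  by move=> k; have [f af e] := regR.2 v0 (nbr k v0); exists f.
by case=> f fP; exists f.
Qed.

Definition raut k : R -> R := sval base_aut_subproof k.

Lemma raut_aut k : is_graph_automorphism (raut k).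
Proof. exact: (svalP base_aut_subproof k).1. Qed.

Lemma raut_base k : raut k v0 = nbr k v0.
Proof. exact: (svalP base_aut_subproof k).2. Qed.

Lemma raut_nbr k l v : raut k (nbr l v) = nbr l (raut k v).
Proof. exact/graph_aut_nbr/raut_aut. Qed.

Lemma raut_id k : ~~ (0 < k <= n) -> raut k =1 id.
Proof.
move=> kn; apply: (@commuting_nbr_eq _ _ v0) => //; first exact: raut_nbr.
by rewrite raut_base nbr_id.
Qed.

Lemma rautK k : involutive (raut k).
Proof.
apply: (@commuting_nbr_eq (raut k \o raut k) id v0) => //= [l u|].
  by rewrite !raut_nbr.
by rewrite raut_base raut_nbr raut_base nbrK.
Qed.

Lemma rautC k l : k.+1 < l -> forall v, raut k (raut l v) = raut l (raut k v).
Proof.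
move=> kl; apply: (@commuting_nbr_eq (raut k \o raut l) (raut l \o raut k) v0).
- by move=> j u /=; rewrite !raut_nbr.
- by move=> j u /=; rewrite !raut_nbr.
by rewrite /= !raut_base !raut_nbr !raut_base (nbrC v0 kl).
Qed.

Lemma raut_facet k v : k < n -> same_facet v0 (raut k v) <-> same_facet v0 v.
Proof.
move=> kn.
have imp u : same_facet v0 u -> same_facet v0 (raut k u).
  move=> /(same_facet_aut (raut_aut k)); apply: same_facet_trans.
  by rewrite raut_base; exact: same_facet_nbr.
by split=> [/imp|]; [rewrite rautK|exact: imp].
Qed.

(** The composite along [w] sends [v0] to the end of the walk [w] from [v0], because automorphisms
    commute with passing to neighbours. If the walk is closed, the composite fixes [v0], hence
    everything. *)
Lemma raut_word_fix u w : acts nbr u w = u ->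
  acts (fun k (g : R -> R) => g \o raut k) id w = id.
Proof.
move=> /(@acts_nbr_fix _ v0) e.
suff gen g : (forall k v, g (nbr k v) = nbr k (g v)) ->
    (forall k v, acts (fun k (g : R -> R) => g \o raut k) g w (nbr k v) =
       nbr k (acts (fun k (g : R -> R) => g \o raut k) g w v)) /\
    acts (fun k (g : R -> R) => g \o raut k) g w v0 = acts nbr (g v0) w.
  have [//|c b] := gen id; apply/funext/(@commuting_nbr_eq _ _ v0) => //.
  by rewrite b e.
elim: w {e} g => //= k w IH g gn.
have [|c b] := IH (g \o raut k); first by move=> l v; rewrite /= raut_nbr gn.
by split; rewrite // b /= raut_base gn.
Qed.

(** * The twisted permutations *)

Variable s' : nat.
Local Notation s := s'.+1.
Local Notation E := (R * 'I_s)%type.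

(* The facet of [v0] and the other facets carry two reflections whose product is
   a rotation of order s, so that crossing between them twice is that rotation. *)
Definition twist (v : R) (i : 'I_s) : 'I_s :=
  (if `[< same_facet v0 v >] then - i else inZp 1 - i)%R.

Definition tgen k (e : E) : E :=
  if k == n.+1 then (e.1, twist e.1 e.2) else (raut k e.1, e.2).

Lemma twistK v : involutive (twist v).
Proof.
move=> i; rewrite /twist; case: `[< _ >]; first by rewrite GRing.opprK.
by rewrite GRing.opprB GRing.addrC GRing.subrK.
Qed.

Lemma tgen_id k : ~~ (0 < k <= n.+1) -> tgen k = id.
Proof.
move=> kn; apply/funext => -[v i]; rewrite /tgen.
case: eqP kn => [->|_ kn]; first by rewrite ltnSn.
by rewrite raut_id //=; lia.
Qed.

Lemma tgenK k : tgen k \o tgen k = id.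
Proof.
apply/funext => -[v i]; rewrite /tgen /=.
by case: eqP => _ /=; [rewrite twistK|rewrite rautK].
Qed.

Lemma tgenC k l : k.+1 < l -> tgen k \o tgen l = tgen l \o tgen k.
Proof.
move=> kl; apply/funext => -[v i]; rewrite /tgen /=.
case: (eqVneq k n.+1) => [kn|kn].
  by rewrite (_ : (l == n.+1) = false) /= ?raut_id //; lia.
case: (eqVneq l n.+1) => [ln|ln] /=; last by rewrite (rautC kl).
(* Here [l] is [n.+1], so [k] is below [n] and [raut k] preserves the facet of [v0]; [twist] looks
   only at membership in it. *)
congr (_, _); rewrite /twist; congr (if _ then _ else _).
by symmetry; apply/asbool_equiv_eq; apply: raut_facet; lia.
Qed.

Lemma tgen_word_fix u w : n.+1 \notin w -> acts nbr u w = u ->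
  acts (fun k (h : E -> E) => h \o tgen k) id w = id.
Proof.
move=> nw /raut_word_fix e; apply/funext => -[v i].
transitivity (acts (fun k (g : R -> R) => g \o raut k) id w v, i); last by rewrite e.
elim/last_ind: w v nw {e} => [//|w k IH] v.
rewrite mem_rcons inE negb_or => /andP[kn nw].
by rewrite -!cats1 !acts_cat /= /tgen eq_sym (negbTE kn) /= IH.
Qed.

(** The square of the product fixes the coordinate in [R] and adds [c v] in Z_s. At [v0], whose last
    neighbour lies in another facet, [c v0] is 1, so the square has order s. Odd powers move [v0] to
    another facet. *)
Lemma tgen_order m : iter m (fun g : E -> E => g \o tgen n \o tgen n.+1) id = id <->
  2 * s %| m.
Proof.
pose rho : E -> E := tgen n \o tgen n.+1.
have iterE j : iter j (fun g : E -> E => g \o tgen n \o tgen n.+1) id = iter j rho.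
  apply/funext => x; elim: j x => //= j IH x.
  by rewrite IH -[RHS]/(iter j.+1 rho x) iterSr.
have rhoE v i : rho (v, i) = (raut n v, twist v i).
  by rewrite /rho /= /tgen eqxx /=; have -> : (n == n.+1) = false by lia.
pose c v : 'I_s := (twist (raut n v) (twist v 0))%R.
have rho2 v i : rho (rho (v, i)) = (v, c v + i)%R.
  rewrite !rhoE rautK; congr (_, _); rewrite /c /twist.
  case: ifP => _; case: ifP => _;
    rewrite ?GRing.oppr0 ?GRing.subr0 ?GRing.opprK ?GRing.opprB ?GRing.addr0 ?GRing.add0r //.
    by rewrite GRing.addrC.
  by rewrite GRing.subrr GRing.add0r GRing.addrC GRing.subrK.
have rho2j j v i : iter j.*2 rho (v, i) = (v, c v *+ j + i)%R.
  elim: j i => [|j IH] i; first by rewrite GRing.mulr0n GRing.add0r.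
  by rewrite doubleS !iterS IH rho2 GRing.mulrS GRing.addrA.
have inZpE (x : 'I_s) j : (x *+ j = inZp (x * j))%R by exact: Zp_mulrn.
have cs v : (c v *+ s = 0)%R.
  by rewrite inZpE; apply: val_inj; rewrite /= modnMl.
rewrite iterE; split=> [e|/dvdnP[j ->]]; last first.
  apply/funext => -[v i]; rewrite mulnCA mul2n rho2j mulnC GRing.mulrnA cs.
  by rewrite GRing.mul0rn GRing.add0r.
have v0v0 : same_facet v0 v0 by exact: rt_refl.
have n0 := @not_same_facet_nbr v0.
have om : ~~ odd m.
  apply/negP => om; have := congr1 (fun f => (f (v0, 0%R)).1) e.
  rewrite -(odd_double_half m) om add1n iterS rho2j rhoE /= raut_base => e2.
  by apply: n0; rewrite e2.
have := congr1 (fun f => (f (v0, 0%R)).2) e.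
rewrite -(odd_double_half m) (negbTE om) add0n rho2j GRing.addr0 /=.
rewrite /c /twist (asboolT v0v0) raut_base (asboolF n0) GRing.oppr0 GRing.subr0.
rewrite inZpE => /(congr1 val) /=; rewrite modnMml mul1n => mj.
by rewrite -mul2n dvdn_pmul2l //; apply/eqP.
Qed.

End RegularManiplex.

(** * Closed walks in K and in its quotient *)

Section Quotient.
Context {d : Order.disp_t} {K : porderType d} (n : nat) (R : colgraph n).
Hypotheses (polyK : is_polytope K n) (regR : is_regular_maniplex R).
Variables (h : flag_graph n K -> R).
Hypothesis hh : is_graph_hom h.

Lemma quotient_acts (x : flag_graph n K) w : exists y : flag_graph n K,
  sval y = acts (adj n) (sval x) w /\ h y = acts (nbr regR) (h x) w.
Proof.
elim/last_ind: w => [|w k [y [ey hy]]]; first by exists x.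
rewrite -cats1 !acts_cat /= -ey -hy.
have [kn|kn] := boolP (0 < k <= n); last by exists y; rewrite adj_id // nbr_id.
have fy : is_flag (sval y) by exact: svalP.
have fa := adj_flag polyK k fy.
exists (exist _ (adj n k (sval y)) fa); split=> //.
have [i ei] := nbr_ord kn; subst k; apply/nbrE/hh.
by apply/(flag_adjacent_atP polyK)/adj_adj_rel.
Qed.

Lemma quotient_fix (Phi : set K) w : is_flag Phi -> acts (adj n) Phi w = Phi ->
  exists u, acts (nbr regR) u w = u.
Proof.
move=> fP e; have [y [ey hy]] := quotient_acts (exist _ Phi fP) w.
exists (h (exist _ Phi fP)); rewrite -hy; congr h.
case: y ey {hy} => Psi fQ /=; rewrite e => ePsi; subst Psi.
by rewrite (Prop_irrelevance fQ fP).
Qed.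

End Quotient.

(** * The mix *)

Section FaceAutomorphism.
Variables (N : nat) (X : flag_system N).
Implicit Types (x y : X) (w : seq nat).

Definition equivariant (f : X -> X) := forall k x, f (act k x) = act k (f x).

Lemma equivariant_acts f x w : equivariant f ->
  f (acts (@act _ X) x w) = acts (@act _ X) (f x) w.
Proof. by move=> fe; elim: w x => //= k w IH x; rewrite IH fe. Qed.

Lemma equivariant_fix f x : equivariant f -> f x = x -> forall y, f y = y.
Proof.
move=> fe e y; have [w <-] := act_connect x y.
by rewrite equivariant_acts // e.
Qed.

(** An arbitrary flag through [A] is chosen; by [face_mapP] the choice does not matter when [f] is
    equivariant. *)
Definition face_map (f : X -> X) (A : face X) : face X :=
  mkface (frk A) (f (sval (cid (fcl_ex A)))).

Lemma equivariant_class f k x y : equivariant f ->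
  face_class k x y -> face_class k (f x) (f y).
Proof. by move=> fe [w kw <-]; exists w; rewrite // equivariant_acts. Qed.

Lemma frk_face_map f A : frk (face_map f A) = frk A.
Proof. by rewrite frk_mkface // frk_max. Qed.

Lemma face_mapP f A x : equivariant f -> fcl A x -> fcl (face_map f A) (f x).
Proof.
move=> fe Ax; rewrite (fclE (fcl_mkface _ _)) frk_face_map.
apply: equivariant_class => //; case: cid => y /= Ay.
by move: Ax; rewrite (fclE Ay).
Qed.

Lemma face_map_cancel f g : equivariant f -> equivariant g -> cancel f g ->
  cancel (face_map f) (face_map g).
Proof.
move=> fe ge fK A; have [x Ax] := fcl_ex A.
apply: (@face_eq_mem _ _ _ _ x) => //; first by rewrite !frk_face_map.
by rewrite -(fK x); apply: face_mapP => //; exact: face_mapP.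
Qed.

Lemma face_map_aut f g : equivariant f -> equivariant g ->
  cancel f g -> cancel g f -> is_automorphism (face_map f).
Proof.
move=> fe ge fK gK.
have le h A B : equivariant h -> (A <= B)%O -> (face_map h A <= face_map h B)%O.
  move=> he /face_leP[AB [x [Ax Bx]]]; apply/face_leP; rewrite !frk_face_map.
  by split=> //; exists (h x); split; exact: face_mapP.
split; first by exists (face_map g); exact: face_map_cancel.
move=> A B; apply/idP/idP; last exact: le.
by move=> /(le g _ _ ge); rewrite !(face_map_cancel fe ge fK).
Qed.

Lemma face_map_Fl f g x : equivariant f -> equivariant g ->
  cancel f g -> cancel g f -> face_map f @` Fl x = Fl (f x).
Proof.
move=> fe ge fK gK; apply/seteqP; split=> [_ [A Ax <-]|A Ax].
  exact: face_mapP.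
exists (face_map g A); last exact: face_map_cancel.
by rewrite /Fl /= -(fK x); exact: face_mapP.
Qed.

Lemma equivariant_same_orbit f g x : equivariant f -> equivariant g ->
  cancel f g -> cancel g f -> same_orbit (Fl x) (Fl (f x)).
Proof.
move=> fe ge fK gK; exists (face_map f); first exact: face_map_aut fe ge fK gK.
exact: face_map_Fl fe ge fK gK.
Qed.

End FaceAutomorphism.

(** The orbit of the final flag reveals the parity of the word. *)
Lemma chiral_orientable {d : Order.disp_t} {P : porderType d} (N i : nat)
    (Phi : set P) (v w : seq nat) :
  is_polytope P N -> is_chiral P N -> is_flag Phi -> i.+2 <= N ->
  all (pred2 i.+1 i.+2) v -> all (pred2 i.+1 i.+2) w ->
  acts (adj N) Phi v = acts (adj N) Phi w -> odd (size v) = odd (size w).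
Proof.
move=> polyP chiP fP iN av aw e.
have par u : all (pred2 i.+1 i.+2) u -> parity N u = odd (size u).
  move=> au; rewrite /parity; congr odd; apply/eqP; rewrite -all_count.
  by apply: sub_all au => k /=; lia.
have := chiral_parity polyP chiP v fP; have := chiral_parity polyP chiP w fP.
rewrite e !par// => h1 h2.
by apply: negb_inj; apply/idP/idP => [/h2/h1|/h1/h2].
Qed.

Section Mix.
Context {d : Order.disp_t} {P : porderType d} (n : nat).
Local Notation N := n.+1.
Hypothesis polyP : is_polytope P N.
Variables (E : Type) (t : nat -> E -> E).
Hypothesis tK : forall k, t k \o t k = id.
Hypothesis tC : forall k l, k.+1 < l -> t k \o t l = t l \o t k.
Hypothesis t_id : forall k, ~~ (0 < k <= N) -> t k = id.

(** Multiplication on the right, so that left multiplication commutes with all colours. *)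
Definition tact k (g : E -> E) : E -> E := g \o t k.

(* This makes the facets of the mix isomorphic to those of [P]. *)
Hypothesis t_fix : forall (Phi : set P) w, is_flag Phi -> N \notin w ->
  acts (adj N) Phi w = Phi -> acts tact id w = id.
Variable Phi0 : set P.
Hypothesis fP0 : is_flag Phi0.

Definition mact k (x : set P * (E -> E)) := (adj N k x.1, tact k x.2).
Definition mix_base : set P * (E -> E) := (Phi0, id).
Definition mix_reach x := exists w, acts mact mix_base w = x.
Definition mix := {x | mix_reach x}.

Lemma mix_inj (x y : mix) : sval x = sval y -> x = y.
Proof.
case: x => x px; case: y => y py /= e; subst y.
by rewrite (Prop_irrelevance px py).
Qed.

Lemma mact_acts x w :
  acts mact x w = (acts (adj N) x.1 w, acts tact x.2 w).
Proof. by elim: w x => [|k w IH] [Phi g] //=; rewrite IH. Qed.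

Lemma tact_acts g w : acts tact g w = g \o acts tact id w.
Proof. by elim/last_ind: w => [//|w k IH]; rewrite -!cats1 !acts_cat /= IH. Qed.

Lemma mact_reach k x : mix_reach x -> mix_reach (mact k x).
Proof. by move=> [w <-]; exists (w ++ [:: k]); rewrite acts_cat. Qed.

Definition mix_act k (x : mix) : mix := exist _ _ (mact_reach k (svalP x)).

Definition phi (x : mix) : set P := (sval x).1.

Lemma phi_flag x : is_flag (phi x).
Proof.
by rewrite /phi; have [w <-] := svalP x; rewrite mact_acts; exact: acts_flag.
Qed.

Lemma mix_acts x w : sval (acts mix_act x w) = acts mact (sval x) w.
Proof. by elim: w x => //= k w IH x; rewrite IH. Qed.

Lemma phi_acts x w : phi (acts mix_act x w) = acts (adj N) (phi x) w.
Proof. by rewrite /phi mix_acts mact_acts. Qed.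

Lemma mix_actK k : involutive (mix_act k).
Proof.
move=> x; apply: mix_inj; rewrite /= /mact /=.
rewrite adjK //; last exact: phi_flag.
by rewrite /tact -compA tK; case: (sval x).
Qed.

Lemma mix_actC k l x : k.+1 < l ->
  mix_act k (mix_act l x) = mix_act l (mix_act k x).
Proof.
move=> kl; apply: mix_inj; rewrite /= /mact /=.
rewrite adjC //; last exact: phi_flag.
by rewrite /tact -compA -(tC kl).
Qed.

Lemma mix_act_id k x : ~~ (0 < k <= N) -> mix_act k x = x.
Proof.
move=> kN; apply: mix_inj; rewrite /= /mact adj_id //= /tact (t_id kN).
by case: (sval x).
Qed.

Lemma mix_act_neq k x : 0 < k <= N -> mix_act k x <> x.
Proof.
move=> kN e; apply: (adj_neq polyP (phi_flag x) kN).
by rewrite -[in RHS]e.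
Qed.

Definition mix0 : mix := exist _ mix_base (ex_intro _ [::] erefl).

Lemma mix0_acts x : exists w, acts mix_act mix0 w = x.
Proof.
by case: x => x [w e]; exists w; apply: mix_inj; rewrite mix_acts.
Qed.

Lemma mix_connect x y : exists w, acts mix_act x w = y.
Proof.
have [v <-] := mix0_acts x; have [w <-] := mix0_acts y.
by exists (rev v ++ w); rewrite acts_cat acts_rev//; exact: mix_actK.
Qed.

Lemma mix_phi_eq x w : N \notin w -> phi (acts mix_act x w) = phi x ->
  acts mix_act x w = x.
Proof.
move=> Nw; rewrite phi_acts => e; apply: mix_inj.
rewrite mix_acts mact_acts tact_acts (t_fix (phi_flag x) Nw e) -/(phi x) e.
by rewrite /phi; case: (sval x).
Qed.

(** A word [w] from [phi x] to [phi y] can avoid all these ranks at once. If [v] leads from [x] to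
    [y] without [N], then [rev w ++ v] avoids [N] and closes up in [P], hence in the mix; so [w]
    itself leads from [x] to [y]. *)
Lemma mix_inter_facet (x y : mix) (S : set nat) :
  (forall k, S k \/ k = N -> exists2 w, k \notin w & acts mix_act x w = y) ->
  exists2 w, (forall k, S k -> k \notin w) & acts mix_act x w = y.
Proof.
move=> link.
have [w [ew aw rw]] := flag_connect polyP (phi_flag x) (phi_flag y).
have wS k : S k \/ k = N -> k \notin w.
  move=> /link[v kv exy]; apply/negP => kw; have kN := allP aw _ kw.
  have [F xF rF] : exists2 F, phi x F & rk F = k.
    by apply: (flag_face_ex polyP (phi_flag x)); lia.
  have yF : phi y F.
    by rewrite -exy phi_acts; apply/(acts_face polyP (phi_flag x)); rewrite ?rF.
  by have := rw F xF yF; rewrite rF kw.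
exists w => [k Sk|]; first by apply: wS; left.
have [v Nv exy] := link N (or_intror erefl).
have eu : acts mix_act (acts mix_act x w) (rev w ++ v) = y.
  by rewrite acts_cat acts_rev //; exact: mix_actK.
rewrite -[RHS]eu; apply/esym/mix_phi_eq.
  by rewrite mem_cat mem_rev negb_or Nv wS //; right.
by rewrite eu phi_acts ew.
Qed.

(** If [N] is not in [S], a word avoiding the largest [k] of [S] below [N] is sorted into letters
    above and below [k]. The first part avoids [S] by the choice of [k]; the second avoids [N], so
    [mix_inter_facet] applies from the intermediate flag [z] on. *)
Lemma mix_inter (x y : mix) (S : set nat) :
  (forall k, S k -> exists2 w, k \notin w & acts mix_act x w = y) ->
  exists2 w, (forall k, S k -> k \notin w) & acts mix_act x w = y.
Proof.
move=> link; have [SN|nSN] := pselect (S N).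
  by apply: mix_inter_facet => k [/link//|->]; exact: link.
pose p k := `[< (S k \/ k = 0) /\ k < N >].
have exp : exists k, p k by exists 0; apply/asboolP; split; [right|].
have pm k : p k -> k <= N by move=> /asboolP[_ /ltnW].
case: (ex_maxnP exp pm) => k /asboolP[Sk kN] kmax.
have [w [kw aw exy]] : exists w, [/\ k \notin w, all (fun l => 0 < l <= N) w &
    acts mix_act x w = y].
  have act_filter v z : acts mix_act z [seq l <- v | 0 < l <= N] = acts mix_act z v.
    by apply: acts_filter => l u; exact: mix_act_id.
  case: Sk => [/link[w kw exy]|->].
    exists [seq l <- w | 0 < l <= N]; rewrite mem_filter filter_all act_filter.
    by split; rewrite // negb_and kw orbT.
  have [w exy] := mix_connect x y.
  by exists [seq l <- w | 0 < l <= N]; rewrite mem_filter filter_all act_filter.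
pose z := acts mix_act x [seq l <- w | k < l].
have ezy : acts mix_act z [seq l <- w | l < k] = y.
  by rewrite /z -acts_split//; exact: mix_actC.
have xzS l : S l -> l \notin [seq l <- w | k < l].
  move=> Sl; rewrite mem_filter; apply/negP => /andP[kl /(allP aw) /= lN].
  have [lN'|lN'] := eqVneq l N; first by case: nSN; rewrite -lN'.
  have /kmax : p l by apply/asboolP; split; [left|lia].
  by rewrite leqNgt kl.
have [|v vS ev] := @mix_inter_facet z y S.
  move=> l Sl; have [kl|lk] := ltnP l k; last first.
    by exists [seq i <- w | i < k]; rewrite // mem_filter; apply/negP; lia.
  case: Sl => [Sl|Sl]; last by lia.
  have [v lv ev] := link l Sl; exists (rev [seq l <- w | k < l] ++ v).
    by rewrite mem_cat mem_rev negb_or lv xzS.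
  by rewrite acts_cat /z acts_rev //; exact: mix_actK.
exists ([seq l <- w | k < l] ++ v); last by rewrite acts_cat.
by move=> l Sl; rewrite mem_cat negb_or xzS // vS.
Qed.

Definition mix_system : flag_system N :=
  @FlagSystem N mix mix_act mix_actK mix_actC mix_act_id mix_act_neq
    (ex_intro _ mix0 I) mix_connect mix_inter.

(** * The covering of P by the mix, and its facets *)

Local Notation Q := (face mix_system).
Implicit Types A B T : Q.

Lemma class_face k (x y : mix_system) H : face_class k x y -> rk H = k ->
  phi x H -> phi y H.
Proof.
move=> [w kw <-] rH xH; rewrite phi_acts.
by apply/(acts_face polyP (phi_flag x)); rewrite ?rH.
Qed.

Lemma class_facet_eq (x y : mix_system) : face_class N x y -> phi x = phi y -> x = y.
Proof. by move=> [w Nw <-] e; apply/esym/mix_phi_eq. Qed.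

Lemma proj_subproof A : { H : P | rk H = frk A /\ forall x, fcl A x -> phi x H }.
Proof.
apply: cid; have [x Ax] := fcl_ex A.
have [H xH rH] := flag_face_ex polyP (phi_flag x) (frk_max A).
exists H; split=> // y; rewrite (fclE Ax) => xy.
exact: class_face xy rH xH.
Qed.

Definition proj A : P := sval (proj_subproof A).

Lemma rk_proj A : rk (proj A) = frk A.
Proof. exact: (svalP (proj_subproof A)).1. Qed.

Lemma phi_proj A x : fcl A x -> phi x (proj A).
Proof. exact: (svalP (proj_subproof A)).2. Qed.

Lemma projE A x H : fcl A x -> phi x H -> rk H = frk A -> proj A = H.
Proof.
move=> Ax xH rH; apply: (flag_rk_inj polyP (phi_flag x)) => //.
  exact: phi_proj.
by rewrite rk_proj.
Qed.

Lemma proj_le A B : (A <= B)%O -> (proj A <= proj B)%O.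
Proof.
move=> /face_leP[AB [x [Ax Bx]]].
by rewrite (flag_rk_le polyP (phi_flag x)) ?rk_proj//; exact: phi_proj.
Qed.

(** Strong connectivity of [P] gives a word from [phi a] to [phi b] without [N] and without the rank
    of [A]. Within the facet [T] a flag is determined by its image, so the word leads from [a] to
    [b], which thus share that face. *)
Lemma facet_inj T A B : frk T = N -> (A <= T)%O -> (B <= T)%O ->
  proj A = proj B -> A = B.
Proof.
move=> rT /face_leP[_ [a [Aa Ta]]] /face_leP[_ [b [Bb Tb]]] e.
have rAB : frk A = frk B by rewrite -!rk_proj e.
have [w [ew aw rw]] := flag_connect polyP (phi_flag a) (phi_flag b).
have Nw : N \notin w.
  by rewrite -rT -rk_proj; apply: rw; exact: phi_proj.
have Aw : frk A \notin w.
  by rewrite -rk_proj; apply: rw; [|rewrite e]; exact: phi_proj.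
have eb : acts mix_act a w = b.
  apply: class_facet_eq; last by rewrite phi_acts.
  apply: (face_class_trans (y := a)).
    by apply: face_class_sym; exact: face_class_acts.
  by move: Tb; rewrite (fclE Ta) rT.
apply: (face_eq_mem rAB (x := b)) => //.
by rewrite (fclE Aa) -eb; exact: face_class_acts.
Qed.

Lemma facet_lift T Psi : frk T = N -> is_flag Psi -> Psi (proj T) ->
  exists2 x, fcl T x & phi x = Psi.
Proof.
move=> rT fQ QT; have [a Ta] := fcl_ex T.
have [w [ew aw rw]] := flag_connect polyP (phi_flag a) fQ.
exists (acts mix_act a w); last by rewrite phi_acts.
rewrite (fclE Ta); apply: face_class_acts.
by rewrite -rk_proj; apply: rw => //; exact: phi_proj.
Qed.

Lemma facet_mkface T x H : frk T = N -> fcl T x -> phi x H -> (H <= proj T)%O ->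
  (mkface (rk H) x <= T)%O /\ proj (mkface (rk H) x) = H.
Proof.
move=> rT Tx xH HT; have rH := rk_max polyP H; split.
  rewrite (face_le_mem (fcl_mkface _ _) Tx) frk_mkface//.
  by rewrite -rk_proj; exact: (rk_le polyP).
by apply: (@projE _ x) => //; [exact: fcl_mkface|rewrite frk_mkface].
Qed.

(** To reflect the order, a flag through both images and [proj T] is lifted to a flag [x] through
    [T]; by injectivity [A] and [B] are the faces of [x] over their images. *)
Lemma facet_iso T : frk T = N ->
  set_bij [set A | (A <= T)%O] [set H | (H <= proj T)%O] proj /\
  {in [set A | (A <= T)%O] &, {mono proj : A B / (A <= B)%O}}.
Proof.
move=> rT; split; first split.
- by move=> A AT; exact: proj_le.
- by move=> A B; rewrite !inE; exact: facet_inj.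
- move=> H HT.
  have [Psi fQ sub] := chain_ext_flag (@chain_set2 _ _ H (proj T) HT).
  have [|x Tx ex] := facet_lift rT fQ; first by apply: sub; right.
  have [|le e] := @facet_mkface T x H rT Tx _ HT; last by exists (mkface (rk H) x).
  by rewrite ex; apply: sub; left.
move=> A B; rewrite !inE => AT BT; apply/idP/idP; last exact: proj_le.
move=> AB; have [Psi fQ sub] : exists2 Psi, is_flag Psi &
    proj A |` [set proj B; proj T] `<=` Psi.
  apply/chain_ext_flag/chain_setU1; first exact/chain_set2/proj_le.
  by move=> H [->|->]; left => //; exact: proj_le.
have [|x Tx ex] := facet_lift rT fQ; first by apply: sub; right; right.
have [||leA eA] := @facet_mkface T x (proj A) rT Tx.
- by rewrite ex; apply: sub; left.
- exact: proj_le.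
have [||leB eB] := @facet_mkface T x (proj B) rT Tx.
- by rewrite ex; apply: sub; right; left.
- exact: proj_le.
apply/face_leP; split; first by rewrite -!rk_proj; exact: (rk_le polyP).
exists x; rewrite -(facet_inj rT leA AT eA) -(facet_inj rT leB BT eB).
by split; exact: fcl_mkface.
Qed.

Lemma mix_extension {d' : Order.disp_t} (K : porderType d') :
  is_extension K P n -> is_extension K Q n.
Proof.
move=> [_ ext]; split; first exact: face_polytope.
move=> T /heightP rT; have [pb pm] := facet_iso rT.
apply: (@isomorphic_trans _ _ _ P _ _ _ [set H | (H <= proj T)%O]).
  by exists proj.
by apply: ext; apply/(rkP polyP); rewrite rk_proj.
Qed.

(** * Chirality and type of the mix *)

Lemma parity_cat v w : parity N (v ++ w) = parity N v (+) parity N w.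
Proof. by rewrite /parity count_cat oddD. Qed.

Lemma parity_rev w : parity N (rev w) = parity N w.
Proof. by rewrite /parity count_rev. Qed.

Hypothesis chiP : is_chiral P N.

(** An even word [w] is realised at [Phi0] by an automorphism of [P]. Paired with left
    multiplication by the element of [w], it takes the flag reached by [u] to the one reached by
    [w ++ u]. *)
Lemma mix_translation w : ~~ parity N w ->
  exists2 f : mix_system -> mix_system, equivariant f & f mix0 = acts mix_act mix0 w.
Proof.
move=> ew; have [a aa ea] := (chiral_parity polyP chiP w fP0).2 ew.
pose th (x : set P * (E -> E)) := (a @` x.1, acts tact id w \o x.2).
have th_acts u : th (acts mact mix_base u) = acts mact mix_base (w ++ u).
  rewrite acts_cat !mact_acts /th /= (aut_acts polyP u aa fP0) ea; congr (_, _).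
  by rewrite [RHS]tact_acts.
have th_reach x : mix_reach x -> mix_reach (th x).
  by move=> [u <-]; exists (w ++ u); rewrite th_acts.
exists (fun x => exist _ _ (th_reach _ (svalP x))).
  move=> k x; apply: mix_inj; rewrite /= /th /mact /=; congr (_, _).
  by have := aut_acts polyP [:: k] aa (phi_flag x).
apply: mix_inj; rewrite mix_acts /=.
by have := th_acts [::]; rewrite cats0.
Qed.

Lemma mix_even_orbit (x : mix_system) w : ~~ parity N w ->
  same_orbit (Fl x) (Fl (acts mix_act x w : mix_system)).
Proof.
have base v : ~~ parity N v ->
    same_orbit (Fl (mix0 : mix_system)) (Fl (acts mix_act mix0 v : mix_system)).
  move=> ev; have [f fe f0] := mix_translation ev.
  have [|g ge g0] := @mix_translation (rev v); first by rewrite parity_rev.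
  have fK : cancel f g.
    apply: (@equivariant_fix _ mix_system (g \o f) mix0).
      by move=> k y /=; rewrite fe ge.
    by rewrite /= f0 (equivariant_acts _ _ ge) g0 -{2}(revK v) acts_rev//; exact: mix_actK.
  have gK : cancel g f.
    apply: (@equivariant_fix _ mix_system (f \o g) mix0).
      by move=> k y /=; rewrite ge fe.
    by rewrite /= g0 (equivariant_acts _ _ fe) f0 acts_rev//; exact: mix_actK.
  rewrite -f0; exact: equivariant_same_orbit fe ge fK gK.
move=> ew; have [u <-] := mix0_acts x.
(* This conjugate of [w] is even and handles the base flag; acting by [u] then carries the two flags
   to [x] and its image under [w]. *)
have par : ~~ parity N (u ++ w ++ rev u).
  by rewrite !parity_cat parity_rev addbA [X in X (+) _]addbC -addbA addbb addbF.
have := same_orbit_acts (face_polytope mix_system) u (Fl_flag _) (base _ par).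
rewrite !acts_Fl; change (@act N mix_system) with mix_act.
rewrite !acts_cat -[X in acts _ (acts _ _ (rev u)) X](revK u) acts_rev//.
exact: mix_actK.
Qed.

Lemma mix_chiral {d' : Order.disp_t} (K : porderType d') : 0 < n ->
  is_polytope K n -> is_chiral K n -> is_extension K P n -> is_chiral Q N.
Proof.
move=> n0 polyK chiK /mix_extension[_ ext].
have polyQ := face_polytope mix_system.
have par2 k l : 0 < k <= N -> 0 < l <= N -> ~~ parity N [:: k; l].
  by move=> kN lN; rewrite /parity /= kN lN.
(* Colour 1 is not [N], as [n] is positive. So an automorphism taking [x] to this neighbour fixes
   the facet [T] and induces one of [K] that relates adjacent flags. *)
have vertex_adj (x : mix_system) : ~ same_orbit (Fl x) (Fl (act 1 x)).
  move=> [g ag eg].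
  pose T : Q := mkface N x.
  have rT : frk T = N by rewrite frk_mkface.
  have Tx1 : fcl T (act 1 x).
    rewrite (fclE (fcl_mkface _ _)) rT; apply: face_class_act; lia.
  have gT : g T = T.
    apply: (flag_rk_inj polyQ (Fl_flag (act 1 x))) => //.
      by rewrite -eg; exists T => //; exact: fcl_mkface.
    have [U [rU Umax gb gm]] := aut_lower_iso polyQ ag.
    by rewrite (rk_lower polyQ polyQ gb gm)//; exact: Umax.
  have hT : is_facet N T by apply/heightP.
  have [f fb fm] := ext T hT.
  have rT' : rk T = N by rewrite face_rk.
  have [h ah eh] := facet_automorphism fb fm ag gT.
  have fL := lower_part_flag fb fm (Fl_flag x) (fcl_mkface _ _).
  apply: (chiral_adj polyK chiK fL (k := 1)) => //.
  rewrite -(lower_part_adj polyQ polyK rT' fb fm)//; first 1 last.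
  - exact: Fl_flag.
  - exact: fcl_mkface.
  by rewrite adj_Fl -eg -eh; exists h.
(* The even word [k], 1 leads from the [k]-neighbour to the 1-neighbour of [x], which reduces [k] to
   1. *)
have any_adj k (x : mix_system) : 0 < k <= N ->
    ~ same_orbit (Fl x) (Fl (act k x)).
  move=> kN h; apply: (vertex_adj x); apply: same_orbit_trans h _.
  have := mix_even_orbit (act k x) (par2 k 1 kN isT).
  by rewrite /= mix_actK.
split; last first.
  move=> Phi Psi [i iN adjPQ].
  have [[x ex] [y ey]] : (exists x, Phi = Fl x) /\ (exists y, Psi = Fl y).
    by case: adjPQ => fP fQ _ _; split; exact: flag_Fl.
  subst Phi Psi; rewrite (adjacent_Fl adjPQ); exact: any_adj.
exists (Fl (mix0 : mix_system)), (Fl (act 1 (mix0 : mix_system))).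
split; [exact: Fl_flag|exact: Fl_flag|exact: vertex_adj|].
move=> _ /flag_Fl[x ->]; have [w <-] := mix0_acts x.
have [ow|ew] := boolP (parity N w); last by left; exact: mix_even_orbit.
right; have := @mix_even_orbit (act 1 (mix0 : mix_system)) (1 :: w).
rewrite -cat1s parity_cat ow => /(_ isT) /=.
by rewrite mix_actK.
Qed.

(** A power of the rotation fixes a flag of the mix when it does so in [P] and is trivial in the
    group. The group condition concerns only words already closed in [P], so that [t_fix] can settle
    the lower entries. *)
Lemma mix_gon (F G : Q) i (p p' : option nat) : is_chiral Q N ->
  (F < G)%O -> frk F = i -> frk G = i.+3 ->
  is_gon (section (proj F) (proj G)) p -> p' <> Some 0 ->
  (forall m (Phi : set P), is_flag Phi -> acts (adj N) Phi (rot_word i m) = Phi ->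
    odflt 0 p %| m -> (acts tact id (rot_word i m) = id <-> odflt 0 p' %| m)) ->
  odflt 0 p %| odflt 0 p' ->
  is_gon (section F G) p'.
Proof.
move=> chiQ FG rF rG gonP p'0 per pp'.
have polyQ := face_polytope mix_system.
have [x xP] := chain_common (chain_set2 (ltW FG)).
have Fx : fcl F x by apply: xP; left.
have Gx : fcl G x by apply: xP; right.
have iN : i.+2 <= N by have := frk_max G; rewrite rG.
have perP m : acts (adj N) (phi x) (rot_word i m) = phi x <-> odflt 0 p %| m.
  rewrite -rot_wordE.
  apply: (@order_of_gon _ _ N polyP i (phi x) (proj F) (proj G)) => //.
  - exact: phi_flag.
  - exact: phi_proj.
  - exact: phi_proj.
  - by rewrite rk_proj.
  - by rewrite rk_proj.
  by move=> v w; apply: chiral_orientable => //; exact: phi_flag.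
apply: (@gon_of_order _ _ N polyQ i (Fl x) F G) => //.
- exact: Fl_flag.
- by rewrite face_rk.
- by rewrite face_rk.
- by move=> v w; apply: chiral_orientable => //; exact: Fl_flag.
move=> m; rewrite rot_wordE acts_Fl; split=> [/Fl_inj e|pm].
  have pm : odflt 0 p %| m by apply/perP; rewrite -phi_acts [acts _ _ _]e.
  apply/(per _ _ (phi_flag x) ((perP m).2 pm) pm); have := congr1 (fun y => (sval y).2) e.
  rewrite mix_acts mact_acts /= tact_acts.
  have [w ew] : mix_reach (sval x) by exact: svalP.
  rewrite -ew mact_acts /= => e2.
  (* The inverse of the group element of [x], which is cancelled on the left of [e2]. *)
  have tw : forall z, acts tact id (rev w) (acts tact id w z) = z.
    have : acts tact (acts tact id (rev w)) (rev (rev w)) = id.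
      by apply: acts_rev => k g; rewrite /tact -compA tK.
    by rewrite revK tact_acts => e3 z; have := congr1 (fun f => f z) e3.
  by apply/funext => z; rewrite -[LHS]tw -[RHS]tw; congr (acts tact id (rev w) _);
    exact: (congr1 (fun f => f z) e2).
congr Fl; apply: mix_inj; rewrite mix_acts mact_acts tact_acts.
have pm' : odflt 0 p %| m by exact: dvdn_trans pm.
have em := (perP m).2 pm'.
rewrite em (per _ _ (phi_flag x) em pm').2 //.
by rewrite /phi; case: (sval x).
Qed.

End Mix.

(** In rank 0 there are no colours, so connectivity leaves a single flag. *)
Lemma chiral_rank_gt0 {d : Order.disp_t} {K : porderType d} (n : nat) :
  is_polytope K n -> is_chiral K n -> 0 < n.
Proof.
case: n => // polyK [[A [B [fA fB nAB _]]] _]; case: nAB.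
have [w [<- aw _]] := flag_connect polyK fA fB.
by case: w aw => [|[]//] _; exact: same_orbit_refl.
Qed.

Theorem theorem4p3 (n : nat) (d : Order.disp_t) (K : porderType d)
    (p : seq (option nat)) :
  is_polytope K n -> is_chiral K n -> has_type K n p ->
  (exists R : colgraph n,
     [/\ is_regular_maniplex R, is_quotient_of R K & at_least_two_facets R]) ->
  forall (d' : Order.disp_t) (P : porderType d') (q : option nat),
    is_extension K P n -> is_chiral P n.+1 -> has_type P n.+1 (rcons p q) ->
    forall s : nat, (0 < s)%N ->
      exists (d'' : Order.disp_t) (Q : porderType d''),
        [/\ is_extension K Q n, is_chiral Q n.+1 &
            has_type Q n.+1 (rcons p (lcm_oo q (2 * s)))].
Proof.
(* From here on [s] is the given integer minus 1, as [tgen] expects. *)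
move=> polyK chiK typK [R [regR [h hh] twoR]] d' P q extP chiP typP [//|s] _.
have n0 := chiral_rank_gt0 polyK chiK.
have [polyP facP] := extP.
have [v0 _] := twoR.
pose t := @tgen n R regR v0 s.
have t_fix (Phi : set P) w : is_flag Phi -> n.+1 \notin w ->
    acts (adj n.+1) Phi w = Phi -> acts (tact t) id w = id.
  (* Letters beyond [n.+1] act trivially on both factors. Dropping them leaves letters at most [n],
     which act within the facet [F] of [Phi]; the closed walk passes to [K] and then to [R]. *)
  move=> fP; pose v := [seq k <- w | k <= n.+1].
  have ev : acts (adj n.+1) Phi v = acts (adj n.+1) Phi w.
    by apply: acts_filter => k x kN; apply: adj_id; lia.
  have -> : acts (tact t) id w = acts (tact t) id v.
    apply/esym/acts_filter => k g kN; rewrite /tact /t tgen_id//; lia.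
  rewrite -{}ev => Nw; have {Nw} Nv : n.+1 \notin v.
    by rewrite mem_filter negb_and Nw orbT.
  have vn : all (fun k => k <= n) v.
    apply/allP => k kv; have kn : k != n.+1 by apply: contraNneq Nv => <-.
    by move: kv; rewrite mem_filter => /andP[kN _]; rewrite -ltnS ltn_neqAle kn.
  move=> ePhi; have [F PF rF] := flag_face_ex polyP fP (leqnSn n.+1).
  have [f fb fm] := facP F ((rkP polyP F n.+1).2 rF).
  have eL := lower_part_acts polyP polyK rF fb fm vn fP PF.
  rewrite ePhi in eL.
  have [u eu] := quotient_fix polyK regR hh (lower_part_flag fb fm fP PF) (esym eL).
  exact: tgen_word_fix Nv eu.
have [Phi0 [_ [fP0 _ _ _]]] := chiP.1.
pose X := @mix_system _ P n polyP _ t (@tgenK _ _ regR v0 s)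
  (@tgenC _ _ regR v0 s) (@tgen_id _ _ regR v0 s) t_fix Phi0 fP0.
have chiQ : is_chiral (face X) n.+1.
  exact: mix_chiral chiP _ _ n0 polyK chiK extP.
exists face_display, (face X); split=> //; first exact: mix_extension extP.
have [sizep gonP] := typP; have [sizepK _] := typK.
split; first by move: sizep; rewrite !size_rcons.
move=> i F G iN FG /heightP rF /heightP rG.
have FG' : (proj F < proj G)%O.
  rewrite lt_neqAle proj_le ?ltW // andbT; apply/eqP => /(congr1 (@rk _ _)).
  by rewrite !rk_proj rF rG; lia.
have gonPi : is_gon (section (proj F) (proj G)) (nth None (rcons p q) i).
  by apply: gonP => //; apply/(rkP polyP); rewrite rk_proj.
have iN' : i < n by [].
have szp : size p = n.-1 by [].
have not0 r (A : set P) : is_gon A r -> r <> Some 0 by case: r => [[|k]|] // [].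
move: gonPi; rewrite !nth_rcons szp; case: ltnP => ip gonPi.
  (* Below the last entry both letters are at most [n], so closed words are trivial in the group and
     the entry of [P] is kept. *)
  apply: (mix_gon chiP chiQ FG rF rG gonPi (not0 _ _ gonPi)) => // m Phi fP ePhi pm.
  split=> // _; apply: (t_fix _ _ fP _ ePhi).
  by apply/negP => /(allP (rot_word_all i m)) /=; lia.
have ei : i = n.-1 by lia.
rewrite ei eqxx in gonPi *.
have lcmE : odflt 0 (lcm_oo q (2 * s.+1)) = lcmn (odflt 0 q) (2 * s.+1).
  by case: (q) => //=; rewrite lcm0n.
rewrite ei in rF rG.
apply: (mix_gon chiP chiQ FG rF rG gonPi).
- have := not0 _ _ gonPi; case: (q) => [[|k]|] //= _ [].
  by apply/eqP; rewrite -lt0n lcmn_gt0 muln_gt0.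
(* In the last section the word is a power of the product of the last two generators, which has
   order 2s. *)
- move=> m Phi fP ePhi pm; rewrite lcmE dvdn_lcm pm /= acts_rot_word.
  by rewrite prednK//; exact: tgen_order.
- by rewrite lcmE; exact: dvdn_lcml.
Qed.
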